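(* There exists a polynomial time randomized algorithm such that, given a positive semidefinite matrix $L\in\mathbb{R}^{m\times m}$ of rank $d$ and a totally unimodular matrix $B\in\mathbb{R}^{d\times m}$ that is a representation of a rank-$d$ regular matroid on ground set $[m]$ with set of bases $\mathcal{B}\subseteq 2^{[m]}$, it outputs a set $S\in\mathcal{B}$ such that, with high probability, $$\det(L_{S,S})\geq \max\left(2^{-O(m)},\,2^{-O(d\log m)}\right)\cdot\mathrm{OPT},$$ where $\mathrm{OPT}:=\max_{S\in\mathcal{B}}\det(L_{S,S})$.
   Context: $L_{S,S}$ is the principal submatrix of $L$ indexed by $S$. A matrix is totally unimodular if every square submatrix has determinant in $\{-1,0,1\}$. $B$ represents the matroid if a set $S\subseteq[m]$ is independent in the matroid exactly when the columns $\{B_i:i\in S\}$ are linearly independent; bases are the maximal independent sets (all of size $d$). *)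

(* Defs.v *)
From HB Require Import structures.
From mathcomp Require Import all_boot all_order all_algebra.
From mathcomp Require Import reals.

Set Implicit Arguments.
Unset Strict Implicit.
Unset Printing Implicit Defensive.

Import Order.TTheory GRing.Theory Num.Theory.
Local Open Scope ring_scope.

Definition principal_submx (R : Type) (m : nat) (L : 'M[R]_m)
    (S : {set 'I_m}) : 'M[R]_#|S| :=
  mxsub (@enum_val _ (mem S)) (@enum_val _ (mem S)) L.

Definition psdmx (R : realType) (m : nat) (L : 'M[R]_m) : Prop :=
  L^T = L /\ forall u : 'cV[R]_m, 0 <= (u^T *m L *m u) ord0 ord0.

Definition totally_unimodular (R : realType) (n m : nat) (A : 'M[R]_(n, m)) :
    Prop :=
  forall (k : nat) (f : 'I_k -> 'I_n) (g : 'I_k -> 'I_m),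
    {homo f : i j / (i < j)%N} -> {homo g : i j / (i < j)%N} ->
    \det (mxsub f g A) \in [:: -1; 0; 1].

Record matroid (T : finType) := Matroid {
  indep : {set T} -> bool;
  indep0 : indep set0;
  indepS : forall A B : {set T}, A \subset B -> indep B -> indep A;
  indepX : forall A B : {set T}, indep A -> indep B -> (#|A| < #|B|)%N ->
    exists2 x, x \in B :\: A & indep (x |: A)
}.

Definition bases (T : finType) (M : matroid T) : {set {set T}} :=
  [set S : {set T} | maxset (indep M) S].

Definition matroid_rank (T : finType) (M : matroid T) : nat :=
  \max_(S : {set T} | indep M S) #|S|.

Definition represents (R : realType) (n m : nat) (A : 'M[R]_(n, m))
    (M : matroid 'I_m) : Prop :=
  forall S : {set 'I_m}, indep M S = free [seq col i A | i <- enum S].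

Definition regular_matroid (R : realType) (m : nat) (M : matroid 'I_m) : Prop :=
  exists (n : nat) (A : 'M[R]_(n, m)), totally_unimodular A /\ represents A M.

(* The default value 0 is harmless when L is positive semidefinite: every
   principal minor is then nonnegative, and a matroid has at least one basis. *)
Definition OPT (R : realType) (m : nat) (L : 'M[R]_m) (M : matroid 'I_m) : R :=
  \big[Num.max/0]_(S in bases M) \det (principal_submx L S).

(* Computation model: a real RAM (unit-cost exact field operations and
   comparisons on reals; no floor, no square root) with fair coin flips,
   presented as structured programs.  Memory consists of natural-number
   registers and of unbounded two-dimensional arrays of reals, addressed by
   natural-number expressions.  There is no multiplication of naturals, so a
   register value has at most linearly many bits in the running time.  The
   syntax does not mention R: the only constants of a program are integers. *)

Inductive nexp :=
| NCst of nat
| NReg of nat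
| NAdd of nexp & nexp
| NSub of nexp & nexp.

Inductive rexp :=
| RCst of int
| RGet of nat & nexp & nexp
| RAdd of rexp & rexp
| RSub of rexp & rexp
| RMul of rexp & rexp
| RDiv of rexp & rexp.

Inductive test :=
| TNLe of nexp & nexp
| TRLe of rexp & rexp
| TNot of test
| TAnd of test & test.

Inductive cmd :=
| Skip
| NSet of nat & nexp
| RSet of nat & nexp & nexp & rexp
| Flip of nat
| Seq of cmd & cmd
| If of test & cmd & cmd
| While of test & cmd.

Record state (R : realType) := State {
  nreg : nat -> nat;
  rarr : nat -> nat -> nat -> R;
  coins : seq bool
}.

Definition upd (A : Type) (f : nat -> A) (x : nat) (v : A) : nat -> A :=
  fun y => if y == x then v else f y.

Section Semantics.
Variable R : realType.
Implicit Types (s : state R).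

Fixpoint neval s (e : nexp) : nat :=
  match e with
  | NCst n => n
  | NReg x => nreg s x
  | NAdd e1 e2 => (neval s e1 + neval s e2)%N
  | NSub e1 e2 => (neval s e1 - neval s e2)%N
  end.

Fixpoint reval s (e : rexp) : R :=
  match e with
  | RCst z => z%:~R
  | RGet a i j => rarr s a (neval s i) (neval s j)
  | RAdd e1 e2 => reval s e1 + reval s e2
  | RSub e1 e2 => reval s e1 - reval s e2
  | RMul e1 e2 => reval s e1 * reval s e2
  | RDiv e1 e2 => reval s e1 / reval s e2
  end.

Fixpoint teval s (t : test) : bool :=
  match t with
  | TNLe e1 e2 => (neval s e1 <= neval s e2)%N
  | TRLe e1 e2 => reval s e1 <= reval s e2
  | TNot t1 => ~~ teval s t1
  | TAnd t1 t2 => teval s t1 && teval s t2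
  end.

Definition set_nreg s (x v : nat) : state R :=
  State (upd (nreg s) x v) (rarr s) (coins s).

Definition set_rarr s (a i j : nat) (v : R) : state R :=
  State (nreg s)
    (upd (rarr s) a (upd (rarr s a) i (upd (rarr s a i) j v))) (coins s).

Definition flip s (x : nat) : state R :=
  State (upd (nreg s) x (head false (coins s))) (rarr s) (behead (coins s)).

(* A configuration is a stack of commands still to be executed and a state; it
   is halted, and then fixed by [step], when the stack is empty.  One step
   costs one unit of time: the expressions of a fixed program have bounded
   size, so this is unit cost per operation up to a constant factor. *)
Definition config := (seq cmd * state R)%type.

Definition step (c : config) : config :=
  match c with
  | ([::], s) => ([::], s)
  | (Skip :: k, s) => (k, s)
  | (NSet x e :: k, s) => (k, set_nreg s x (neval s e))
  | (RSet a i j e :: k, s) =>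
      (k, set_rarr s a (neval s i) (neval s j) (reval s e))
  | (Flip x :: k, s) => (k, flip s x)
  | (Seq c1 c2 :: k, s) => (c1 :: c2 :: k, s)
  | (If t c1 c2 :: k, s) => ((if teval s t then c1 else c2) :: k, s)
  | (While t c1 :: k, s) =>
      (if teval s t then c1 :: While t c1 :: k else k, s)
  end.

Definition mx_array (n m : nat) (A : 'M[R]_(n, m)) (i j : nat) : R :=
  match insub i, insub j with
  | Some i', Some j' => A i' j'
  | _, _ => 0
  end.

(* Input convention: registers 0 and 1 hold m and d, arrays 0 and 1 hold L and
   B; everything else is zero.  Output convention: the set of the i < m such
   that entry (i, 0) of array 2 is nonzero. *)
Definition init (m d : nat) (L : 'M[R]_m) (B : 'M[R]_(d, m)) (w : seq bool) :
    state R :=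
  State (nth 0%N [:: m; d])
    (fun a => match a with
              | 0 => mx_array L
              | 1 => mx_array B
              | _ => fun _ _ => 0
              end)
    w.

Definition run (P : cmd) (T m d : nat) (L : 'M[R]_m) (B : 'M[R]_(d, m))
    (w : seq bool) : config :=
  iter T step ([:: P], init L B w).

Definition halted (c : config) : bool := nilp c.1.

Definition output (m : nat) (c : config) : {set 'I_m} :=
  [set i : 'I_m | rarr c.2 2 i 0 != 0].

End Semantics.

(* Probability over T independent fair coins.  A run of T steps flips at most T
   coins, so the tape of such a run is never exhausted. *)
Definition coin_prob (R : realType) (T : nat) (E : T.-tuple bool -> bool) : R :=
  #|[set w : T.-tuple bool | E w]|%:R / 2 ^+ T.

(* Main.v *)
Require Import Defs.
From HB Require Import structures.
From mathcomp Require Import all_boot all_order all_algebra.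
From mathcomp Require Import ring lra zify.
From mathcomp Require Import reals sequences exp.

(** Write [L = C^T H C] with [H] positive semidefinite of order [d].  By
    multilinearity [g x = \det (B X C^T)], with [X] the diagonal matrix of [x],
    is a homogeneous multiaffine polynomial of degree [d] whose coefficient at a
    set [S] of size [d] is [\det B_S * \det C_S]; since [B] is totally unimodular,
    [\det L_SS = \det H * (coefficient of S)^2] on bases.  The computable quantity
    [\det (B X L X B^T)] equals [\det H * g(x)^2].

    For [x] uniform in the grid [{1, .., N}^m], [N = 2^(m+3)], and any [S], one has
    [|g x| >= |coefficient of S| * (N / 256)^d] with probability at least 1/2:
    reveal the coordinates outside [S], which leaves the coefficient of [S]
    unchanged, and then those of [S] one at a time; each of these costs a factor
    [|v + t|] whose inverse square root has mean at most [4 / sqrt N] away from two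
    exceptional values [v].

    Greedy rounding: while more than [d] weights are nonzero, delete the one whose
    deletion keeps [g^2] largest.  As the values of [g] after the single deletions
    from a support of size [t] add up to [(t - d) * g], at most a factor
    ['C(m, d)] of [|g|] is lost in total, and the final support is a basis [S] with
    [|g| <= N^d * |coefficient of S|].  Hence each trial loses at most
    [(256^d * 'C(m, d))^2] with probability 1/2, and [k m] trials fail together
    with probability at most [2^(- k m) <= m^(-k)].

    Determinants of the forms are evaluated without pivoting or square roots by
    successive rank-one Schur complements, where a zero pivot of a positive
    semidefinite form forces a zero determinant. *)

Set Implicit Arguments.
Unset Strict Implicit.
Unset Printing Implicit Defensive.

Import Order.TTheory GRing.Theory Num.Theory.
Local Open Scope ring_scope.

(** * Positive semidefinite forms *)

Section PsdForm.
Variables (R : realType) (m : nat).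
Implicit Types (A : 'M[R]_m) (y z : 'rV[R]_m).

Definition form A y z : R := (y *m A *m z^T) 0 0.

Lemma formE A y z : form A y z = \sum_i \sum_j y 0 i * A i j * z 0 j.
Proof.
rewrite /form mxE exchange_big /=; apply: eq_bigr => j _.
by rewrite !mxE big_distrl.
Qed.

Lemma formDl A y1 y2 z : form A (y1 + y2) z = form A y1 z + form A y2 z.
Proof. by rewrite /form !mulmxDl mxE. Qed.

Lemma formDr A y z1 z2 : form A y (z1 + z2) = form A y z1 + form A y z2.
Proof. by rewrite /form linearD mulmxDr mxE. Qed.

Lemma formZl A a y z : form A (a *: y) z = a * form A y z.
Proof. by rewrite /form -!scalemxAl mxE. Qed.

Lemma formZr A a y z : form A y (a *: z) = a * form A y z.
Proof. by rewrite /form linearZ /= -scalemxAr mxE. Qed.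

Lemma formC A y z : A^T = A -> form A y z = form A z y.
Proof.
move=> symA; have -> : form A y z = (y *m A *m z^T)^T 0 0 by rewrite [RHS]mxE.
by rewrite /form !trmx_mul trmxK symA mulmxA.
Qed.

Lemma psd_form_ge0 A y : psdmx A -> 0 <= form A y y.
Proof. by case=> _ /(_ y^T); rewrite trmxK. Qed.

(** With [v = y *m A], [c = form A v v] and [q] the squared norm of [v], the form at [- t *: y + v]
    equals [c - 2 t q]; this would be negative for large [t] unless [q = 0]. *)
Lemma psd_form0 A y : psdmx A -> form A y y = 0 -> y *m A = 0.
Proof.
move=> psdA y0; have symA := psdA.1.
set v := y *m A; pose q := \sum_i v 0 i ^+ 2.
have fq : form A y v = q.
  by rewrite /form -/v mxE; apply: eq_bigr => i _; rewrite [v^T _ _]mxE expr2.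
have q0 : q = 0.
  have qge0 : 0 <= q by apply: sumr_ge0 => i _; apply: sqr_ge0.
  case: (eqVneq q 0) => // qn0.
  have qgt0 : 0 < q by rewrite lt_neqAle eq_sym qn0.
  pose c := form A v v; have cge0 : 0 <= c by apply: psd_form_ge0.
  (* The choice [t = (c + 1) / q] gives the value [- c - 2]. *)
  have := psd_form_ge0 (- ((c + 1) / q) *: y + v) psdA.
  rewrite formDl !formDr !formZl !formZr y0 (formC v y symA) fq -/c !mulr0 add0r.
  rewrite !mulNr mulfVK //; lra.
apply/rowP => i; rewrite [RHS]mxE; apply/eqP; rewrite -sqrf_eq0.
have /eqP := q0; rewrite psumr_eq0; last by move=> j _; apply: sqr_ge0.
by move=> /allP /(_ i); rewrite mem_index_enum; apply.
Qed.

(* With [x / 0 = 0] this is [A] itself when [form A y y = 0]. *)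
Definition schur A y : 'M[R]_m :=
  A - (form A y y)^-1 *: ((y *m A)^T *m (y *m A)).

Lemma form_schur A y u v : A^T = A ->
  form (schur A y) u v = form A u v - form A u y * form A y v / form A y y.
Proof.
move=> symA; rewrite {1}/form /schur mulmxBr mulmxBl.
rewrite -scalemxAr -scalemxAl (mulmxA u (y *m A)^T).
set p := u *m (y *m A)^T; rewrite -[p *m _ *m _]mulmxA.
rewrite [LHS]mxE -/(form A u v); congr (_ + _).
rewrite mxE mxE; congr (- _); rewrite [RHS]mulrC; congr (_ * _).
rewrite (_ : p = (form A u y)%:M); last first.
  by apply/matrixP => i j; rewrite !ord1 /p trmx_mul symA mulmxA [RHS]mxE eqxx.
by rewrite mul_scalar_mx mxE.
Qed.

(** The Schur form at [v] is the value of [form A] at [v + t *: y] for the minimising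
    [t = - form A y v / form A y y]; for a zero pivot it is the form of [A] itself. *)
Lemma psd_schur A y : psdmx A -> psdmx (schur A y).
Proof.
move=> psdA; have symA := psdA.1; split.
  by rewrite /schur linearB linearZ /= trmx_mul trmxK symA.
move=> u; pose v := u^T; have -> : u^T *m schur A y *m u = v *m schur A y *m v^T.
  by rewrite trmxK.
rewrite -/(form _ v v) form_schur // (formC v y symA).
set al := form A y y; case: (eqVneq al 0) => [-> | al0].
  by rewrite invr0 mulr0 subr0; apply: psd_form_ge0.
have := psd_form_ge0 (- (form A y v / al) *: y + v) psdA.
rewrite formDl !formDr !formZl !formZr (formC v y symA) -/al.
set b := form A y v; set c := form A v v.
suff -> : - (b / al) * (- (b / al) * al) + - (b / al) * b + (- (b / al) * b + c)
  = c - b * b / al by [].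
by field.
Qed.

Definition gram_det n (y : nat -> 'rV[R]_m) A : R :=
  \det (\matrix_(a < n, b < n) form A (y a) (y b)).

Lemma gram_det0 (y : nat -> 'rV[R]_m) A : gram_det 0 y A = 1.
Proof. exact: det_mx00. Qed.

(** One step of block elimination. A zero pivot cannot obstruct it: by [psd_form0] the first row of
    the Gram matrix then vanishes, and both sides are 0. *)
Lemma gram_detS n (y : nat -> 'rV[R]_m) A : psdmx A ->
  gram_det n.+1 y A =
  form A (y 0%N) (y 0%N) * gram_det n (fun a => y a.+1) (schur A (y 0%N)).
Proof.
move=> psdA; have symA := psdA.1; set al := form A _ _.
rewrite /gram_det; case: (eqVneq al 0) => [al0 | aln0].
  rewrite al0 mul0r (expand_det_row _ 0) big1 // => j _.
  by rewrite mxE /form (psd_form0 psdA al0) mul0mx mxE mul0r.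
set G := \matrix_(a, b) _.
pose F : 'M[R]_(1 + n) := G.
have -> : \det G = \det F by [].
pose w : 'rV[R]_n := \row_b form A (y 0%N) (y b.+1).
pose G1 : 'M[R]_n := \matrix_(a, b) form (schur A (y 0%N)) (y a.+1) (y b.+1).
have -> : F = block_mx 1%:M 0 (al^-1 *: w^T) 1%:M *m block_mx al%:M w 0 G1.
  rewrite mulmx_block !mul1mx !mul0mx !addr0 mul_mx_scalar scalerA.
  rewrite divff // scale1r -[LHS]submxK; congr block_mx.
  - apply/matrixP => i j; rewrite !ord1 [RHS]mxE eqxx 3![LHS]mxE.
    by rewrite /al; congr form; congr y.
  - apply/matrixP => i j; rewrite !ord1 [RHS]mxE 3![LHS]mxE.
    by congr form; congr y.
  - apply/matrixP => i j; rewrite !ord1 2![RHS]mxE 3![LHS]mxE.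
    exact: formC.
  - apply/matrixP => i j; rewrite 3![LHS]mxE [RHS]mxE [G1 _ _]mxE.
    rewrite [X in _ = X + _]mxE big_ord1 [w _ _]mxE [X in X * _]mxE [w^T _ _]mxE.
    rewrite [w _ _]mxE form_schur //.
    rewrite (formC (y i.+1) (y 0%N) symA) -/al.
    rewrite [al^-1 * _]mulrC mulrAC addrC subrK.
    by congr form; congr y.
by rewrite det_mulmx det_lblock det_ublock !det1 det_scalar1 !mul1r.
Qed.

Lemma gram_det_ge0 n (y : nat -> 'rV[R]_m) A : psdmx A -> 0 <= gram_det n y A.
Proof.
elim: n y A => [|n IH] y A psdA; first by rewrite gram_det0.
rewrite gram_detS // mulr_ge0 ?psd_form_ge0 //.
by apply: IH; apply: psd_schur.
Qed.

End PsdForm.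

Lemma det_psd_ge0 (R : realType) (m : nat) (A : 'M[R]_m) :
  psdmx A -> 0 <= \det A.
Proof.
move=> psdA.
have -> : \det A = gram_det m (fun a => \row_j (j == a :> nat)%:R) A.
  congr (\det _); apply/matrixP => a b; rewrite mxE formE.
  rewrite (bigD1 a) //= [X in _ + X]big1 ?addr0; last first.
    move=> i ia; rewrite big1 // => j _.
    by rewrite !mxE (negPf (_ : (i != a :> nat))) ?mul0r.
  rewrite (bigD1 b) //= big1 ?addr0.
    by rewrite !mxE !eqxx mul1r mulr1.
  by move=> j jb; rewrite !mxE (negPf (_ : (j != b :> nat))) // mulr0.
exact: gram_det_ge0.
Qed.

(** * Homogeneous multiaffine polynomials and greedy deletion *)

Section Multiaffine.
Variables (R : realType) (m : nat).
Implicit Types (x y : {ffun 'I_m -> R}) (c : {set 'I_m} -> R).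

Definition mpeval c x : R := \sum_(A : {set 'I_m}) c A * \prod_(k in A) x k.

Definition homog (d : nat) c := forall A : {set 'I_m}, #|A| != d -> c A = 0.

Definition xdel x (i : 'I_m) : {ffun 'I_m -> R} :=
  [ffun j => if j == i then 0 else x j].

Definition xsqr x : {ffun 'I_m -> R} := [ffun j => x j ^+ 2].

Definition xsupp x : {set 'I_m} := [set i | x i != 0].

Lemma xsupp_del x i : xsupp (xdel x i) = xsupp x :\ i.
Proof.
apply/setP => j; rewrite !inE ffunE; case: (j == i); rewrite ?eqxx //.
Qed.

Lemma xsupp_sqr x : xsupp (xsqr x) = xsupp x.
Proof. by apply/setP => j; rewrite !inE ffunE sqrf_eq0. Qed.

Lemma xdel_sqr x i : xdel (xsqr x) i = xsqr (xdel x i).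
Proof.
by apply/ffunP => j; rewrite !ffunE; case: (j == i); rewrite ?expr0n.
Qed.

(** Deleting [i] kills exactly the monomials that contain [i], so each monomial of degree [d] inside
    the support survives [#|xsupp x| - d] of the deletions; the others vanish at [x] already. *)
Lemma mpeval_del_sum d c x : homog d c ->
  \sum_(i in xsupp x) mpeval c (xdel x i) =
  (#|xsupp x|%:R - d%:R) * mpeval c x.
Proof.
move=> hc; rewrite /mpeval exchange_big mulr_sumr /=; apply: eq_bigr => A _.
case: (eqVneq #|A| d) => [Ad | /hc ->]; last first.
  by rewrite mul0r mulr0 big1 // => i _; rewrite mul0r.
rewrite -mulr_sumr mulrCA; congr (_ * _).
have delE i : \prod_(k in A) xdel x i k =
    if i \notin A then \prod_(k in A) x k else 0.
  case: ifPn => [iA | /negPn iA]; last by rewrite (bigD1 i) //= ffunE eqxx mul0r.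
  by apply: eq_bigr => k kA; rewrite ffunE; case: eqP => // ki; rewrite -ki kA in iA.
case: (boolP (A \subset xsupp x)) => [sAx | /subsetPn[k kA]].
  rewrite (eq_bigr _ (fun i _ => delE i)) -big_mkcondr /= sumr_const.
  rewrite -[_ *+ _]mulr_natl; congr (_ * _).
  rewrite -natrB -Ad; last exact: subset_leq_card.
  have -> : #|A| = #|xsupp x :&: A| by rewrite (setIidPr sAx).
  rewrite -cardsD; congr _%:R; apply: eq_card => i; by rewrite !inE unfold_in inE andbC.
rewrite inE negbK => /eqP xk.
have p0 : \prod_(k in A) x k = 0 by rewrite (bigD1 k) //= xk mul0r.
by rewrite p0 mulr0 big1 // => i _; rewrite delE p0 if_same.
Qed.

(** A relation rather than a function, so that any choice among tied maxima is covered. The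
    recursion peels off the last deletion, as suits a loop invariant. *)
Fixpoint greedy (f : {ffun 'I_m -> R} -> R) n x x' : Prop :=
  if n is n'.+1 then
    exists y i, [/\ greedy f n' x y, y i != 0,
      forall j, y j != 0 -> f (xdel y j) <= f (xdel y i) & x' = xdel y i]
  else x' = x.

Lemma greedy_supp f n x x' : greedy f n x x' ->
  #|xsupp x| = (#|xsupp x'| + n)%N /\ forall j, x' j = 0 \/ x' j = x j.
Proof.
elim: n x' => [|n IH] x' /=; first by move->; rewrite addn0; split=> // j; right.
case=> y [i [/IH[ny ye] yi _ ->]]; split.
  by rewrite ny xsupp_del (cardsD1 i (xsupp y)) inE yi /= add1n addSnnS.
by move=> j; rewrite ffunE; case: eqP => _; [left | exact: ye].
Qed.

(** By [mpeval_del_sum] and the triangle inequality, the best deletion at support size [s] keeps at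
    least the fraction [(s - d) / s] of [|g|]. These fractions telescope to a quotient of binomial
    coefficients, squared here because [f = h * g ^ 2]. *)
Lemma greedy_sqr d c (h : R) f n x x' : homog d c -> 0 <= h ->
    (forall y, f y = h * mpeval c y ^+ 2) ->
    greedy f n x x' -> (d + n <= #|xsupp x|)%N ->
  f x * 'C(#|xsupp x| - n, d)%:R ^+ 2 <= f x' * 'C(#|xsupp x|, d)%:R ^+ 2.
Proof.
move=> hc h0 fE; set t := #|xsupp x|.
case: (eqVneq h 0) => [hE _ _ | hn0]; first by rewrite !fE hE !mul0r.
have {h0 hn0} hgt0 : 0 < h by rewrite lt_neqAle eq_sym hn0.
elim: n x' => [|n IH] x'; first by move=> /= ->; rewrite subn0.
move=> /= [y [i [gy yi ymax ->]]] dn.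
have {}IH := IH y gy (leq_trans (leq_add (leqnn d) (leqnSn n)) dn).
have [tE _] := greedy_supp gy; rewrite -/t in tE.
set s := #|xsupp y| in tE; rewrite tE addnK in IH *.
have sd : (d < s)%N by move: dn; rewrite tE; lia.
rewrite (_ : s + n - n.+1 = s.-1)%N; last by lia.
set Ct := 'C(s + n, d)%:R in IH *.
have step : f y * (s%:R - d%:R) ^+ 2 <= f (xdel y i) * s%:R ^+ 2.
  rewrite !fE -(mulrA h) -[leRHS](mulrA h) ler_pM2l //.
  rewrite -!exprMn -[leLHS]real_normK ?num_real // -[leRHS]real_normK ?num_real //.
  rewrite ler_sqr ?nnegrE ?normr_ge0 // mulrC -(mpeval_del_sum y hc).
  apply: le_trans (ler_norm_sum _ _ _) _; rewrite normrM normr_nat mulr_natr.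
  rewrite -sumr_const; apply: ler_sum => j; rewrite inE => yj.
  have := ymax j yj; rewrite !fE ler_pM2l //.
  rewrite -[leLHS]real_normK ?num_real // -[leRHS]real_normK ?num_real //.
  by rewrite ler_sqr ?nnegrE ?normr_ge0.
have sp : 0 < s%:R ^+ 2 :> R by rewrite exprn_gt0 // ltr0n; lia.
rewrite -(ler_pM2r sp).
(* The telescoping identity [s * 'C(s.-1, d) = (s - d) * 'C(s, d)]. *)
have -> : f x * 'C(s.-1, d)%:R ^+ 2 * s%:R ^+ 2 =
          f x * 'C(s, d)%:R ^+ 2 * (s%:R - d%:R) ^+ 2.
  rewrite -(mulrA (f x)) -[RHS](mulrA (f x)) -!exprMn; congr (_ * _); congr (_ ^+ 2).
  by rewrite -natrB ?(ltnW sd) // -!natrM mulnC mul_bin_down mulnC.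
apply: le_trans (_ : f y * Ct ^+ 2 * (s%:R - d%:R) ^+ 2 <= _).
  by rewrite ler_wpM2r ?sqr_ge0.
by rewrite mulrAC [leRHS]mulrAC ler_wpM2r ?sqr_ge0.
Qed.

(** Used for the default basis, where [f] is multiaffine in the squared weights. If the best
    deletion gave 0, nonnegativity would make every deletion give 0, and [mpeval_del_sum] would
    force [f] to vanish before the deletion too, the support being larger than [d]. *)
Lemma greedy_neq0 d c f n x x' : homog d c ->
    (forall y, 0 <= f y) -> (forall y, f y = mpeval c (xsqr y)) ->
    greedy f n x x' -> (d + n <= #|xsupp x|)%N -> f x != 0 -> f x' != 0.
Proof.
move=> hc f0 fE; elim: n x' => [|n IH] x'; first by move=> /= ->.
move=> /= [y [i [gy yi ymax ->]]] dn fx.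
have {IH fx} fy := IH y gy (leq_trans (leq_add (leqnn d) (leqnSn n)) dn) fx.
have [tE _] := greedy_supp gy.
have sd : (d < #|xsupp y|)%N by move: dn; rewrite tE addnS -addSn leq_add2r.
apply: contra_neq fy => fdel; apply/eqP.
have /eqP := mpeval_del_sum (xsqr y) hc.
rewrite xsupp_sqr -fE big1 => [|j]; last first.
  rewrite inE => yj; rewrite xdel_sqr -fE; apply/eqP.
  by rewrite eq_le f0 andbT -fdel ymax.
rewrite eq_sym mulf_eq0 subr_eq0 eqr_nat => /orP[/eqP E|//]; by rewrite E ltnn in sd.
Qed.

End Multiaffine.

(** * Determinants of scaled matrices *)

Section ScaledDet.
Variables (R : realType) (m d : nat).
Implicit Types (x : {ffun 'I_m -> R}) (A : 'M[R]_m) (B C : 'M[R]_(d, m)).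

Definition scalemxcol B x : 'M[R]_(d, m) := \matrix_(i, j) (B i j * x j).

Definition congdet A B x : R :=
  \det (scalemxcol B x *m A *m (scalemxcol B x)^T).

Definition pairdet B C x : R := \det (scalemxcol B x *m C^T).

(** The Cauchy-Binet coefficient [\det B_S * \det C_S], written as a sum over injections with image
    [S] so that no enumeration of [S] has to be chosen; [paircoef_supp] recovers the product. *)
Definition paircoef B C (S : {set 'I_m}) : R :=
  \sum_(f : {ffun 'I_d -> 'I_m} | injectiveb f && (f @: setT == S))
    (\prod_i B i (f i)) * \det (\matrix_(i < d, j < d) C j (f i)).

Lemma paircoef_homog B C : homog d (paircoef B C).
Proof.
move=> S dS; rewrite /paircoef big1 // => f /andP[/injectiveP injf /eqP fS].
by rewrite -fS card_imset // cardsT card_ord eqxx in dS.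
Qed.

(** Expand each row of the product over the column index [f i] that it uses. A non-injective [f]
    yields a determinant with two equal rows; the injective ones are grouped by their image. *)
Lemma pairdetE B C x : pairdet B C x = mpeval (paircoef B C) x.
Proof.
pose Fd (f : {ffun 'I_d -> 'I_m}) : R :=
  (\prod_i B i (f i)) * \det (\matrix_(i < d, j < d) C j (f i)).
have -> : pairdet B C x = \sum_(f : {ffun 'I_d -> 'I_m}) Fd f * \prod_i x (f i).
  rewrite /pairdet /determinant.
  under eq_bigr => s _ do under eq_bigr => i _ do rewrite mxE.
  under eq_bigr => s _ do rewrite bigA_distr_bigA /= mulr_sumr.
  rewrite exchange_big /=; apply: eq_bigr => f _.
  rewrite /Fd mulrAC /determinant mulr_sumr; apply: eq_bigr => s _.
  rewrite mulrCA; congr (_ * _); rewrite -!big_split /=.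
  by apply: eq_bigr => i _; rewrite !mxE.
rewrite (bigID (fun f : {ffun 'I_d -> 'I_m} => injectiveb f)) /=.
rewrite [X in _ + X]big1 ?addr0; last first.
  move=> f /injectivePn[i [j ij fij]].
  rewrite /Fd (determinant_alternate ij) ?mulr0 ?mul0r //.
  by move=> k; rewrite !mxE fij.
rewrite (partition_big (fun f : {ffun 'I_d -> 'I_m} => f @: setT) xpredT) //=.
apply: eq_bigr => S _; rewrite /paircoef mulr_suml.
apply: eq_bigr => f /andP[/injectiveP injf /eqP fS]; congr (_ * _).
rewrite -fS big_imset /=; last by move=> i j _ _; apply: injf.
by apply: eq_bigl => i; rewrite inE.
Qed.

Lemma pairdet_supp (e : 'I_d -> 'I_m) B C x : injective e ->
    (forall k, k \notin e @: setT -> x k = 0) ->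
  pairdet B C x = (\prod_i x (e i)) * (\det (colsub e B) * \det (colsub e C)).
Proof.
move=> inje x0; rewrite /pairdet.
have -> : scalemxcol B x *m C^T =
    colsub e B *m diag_mx (\row_i x (e i)) *m (colsub e C)^T.
  apply/matrixP => i j; rewrite !mxE (bigID (mem (e @: setT))) /=.
  rewrite [X in _ + X]big1 ?addr0; last first.
    by move=> k /x0 xk; rewrite !mxE xk mulr0 mul0r.
  rewrite big_imset /=; last by move=> a b _ _; apply: inje.
  rewrite (eq_bigl xpredT); last by move=> a; rewrite inE.
  by apply: eq_bigr => a _; rewrite mul_mx_diag !mxE.
rewrite !det_mulmx det_tr det_diag mulrAC mulrC.
by congr (_ * _); apply: eq_bigr => i _; rewrite mxE.
Qed.

(** Evaluate at the indicator of the image of [e]: among the monomials of degree [d] only that of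
    the image survives, with value 1. *)
Lemma paircoef_supp (e : 'I_d -> 'I_m) B C : injective e ->
  paircoef B C (e @: setT) = \det (colsub e B) * \det (colsub e C).
Proof.
move=> inje; pose x : {ffun 'I_m -> R} := [ffun k => (k \in e @: setT)%:R].
have x1 i : x (e i) = 1 by rewrite ffunE imset_f // inE.
have := pairdetE B C x; rewrite (pairdet_supp _ _ inje) => [|k kn]; last first.
  by rewrite ffunE (negPf kn).
rewrite big1 // mul1r => ->; rewrite /mpeval (bigD1 (e @: setT)) //=.
rewrite [X in X * _ + _]/paircoef -/(paircoef B C _).
rewrite [X in _ * X]big1 ?mulr1 => [|k kS]; last by rewrite ffunE kS.
rewrite big1 ?addr0 // => S Se; case: (boolP (#|S| == d)) => [/eqP Sd | Sd].
  case: (boolP (S \subset e @: setT)) => [sS | /subsetPn[k kS ke]].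
    by case/eqP: Se; apply/eqP; rewrite eqEcard sS card_imset // cardsT card_ord Sd /=.
  by rewrite (bigD1 k) //= ffunE (negPf ke) mul0r mulr0.
by rewrite (paircoef_homog B C Sd) mul0r.
Qed.

Lemma congdet_fact A B C (H : 'M[R]_d) x : A = C^T *m H *m C ->
  congdet A B x = \det H * pairdet B C x ^+ 2.
Proof.
move=> ->; rewrite /congdet /pairdet.
set Y := scalemxcol B x.
have -> : Y *m (C^T *m H *m C) *m Y^T = (Y *m C^T) *m H *m (Y *m C^T)^T.
  by rewrite trmx_mul trmxK !mulmxA.
by rewrite !det_mulmx det_tr mulrAC mulrC expr2.
Qed.

Lemma congdet1 B x : congdet 1%:M B x = pairdet B B (xsqr x).
Proof.
rewrite /congdet /pairdet mulmx1; congr (\det _); apply/matrixP => i j.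
by rewrite !mxE; apply: eq_bigr => k _; rewrite !mxE ffunE; ring.
Qed.

Lemma congdet_gram A B x :
  congdet A B x =
  gram_det d (fun a => \row_j (mx_array B a j * x j)) A.
Proof.
congr (\det _); apply/matrixP => a b; rewrite [RHS]mxE /form.
have rowE (c : 'I_d) : \row_j (mx_array B c j * x j) = row c (scalemxcol B x).
  by apply/rowP => j; rewrite !mxE /mx_array !valK.
rewrite !rowE -row_mul tr_row [LHS]mxE [RHS]mxE.
by apply: eq_bigr => k _; rewrite [row _ _ _ _]mxE [col _ _ _ _]mxE.
Qed.

Lemma congdet_ge0 A B x : psdmx A -> 0 <= congdet A B x.
Proof. by rewrite congdet_gram; apply: gram_det_ge0. Qed.

End ScaledDet.

Lemma psdmx1 (R : realType) (m : nat) : psdmx (1%:M : 'M[R]_m).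
Proof.
split=> [|u]; first exact: trmx1.
rewrite mulmx1 mxE; apply: sumr_ge0 => i _.
by rewrite mxE -expr2 sqr_ge0.
Qed.

(** Take for [C] a basis of the row space of [L] and for [P] its pseudoinverse. Then [L P C = L], by
    symmetry also [C^T P^T L = L], and [H = P^T L P] is a congruence of [L], hence positive
    semidefinite. *)
Lemma psd_rank_fact (R : realType) (m : nat) (L : 'M[R]_m) : psdmx L ->
  exists (C : 'M[R]_(\rank L, m)) (H : 'M[R]_(\rank L)),
    L = C^T *m H *m C /\ psdmx H.
Proof.
move=> psdL; have symL := psdL.1.
set C := row_base L; pose P := pinvmx C.
have LPC : L *m P *m C = L by apply: mulmxKpV; rewrite /C eq_row_base.
move: C P LPC => C P LPC.
have H_psd : psdmx (P^T *m L *m P).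
  split=> [|u]; first by rewrite !trmx_mul trmxK symL mulmxA.
  have := psdL.2 (P *m u); rewrite trmx_mul !mulmxA.
  by [].
exists C, (P^T *m L *m P); split=> //.
have LCP : C^T *m P^T *m L = L.
  by have := congr1 trmx LPC; rewrite !trmx_mul symL mulmxA.
by rewrite !mulmxA LCP LPC.
Qed.

(** * Bases of a represented matroid *)

Section Bases.
Variables (T : finType) (M : matroid T).

Lemma basis_card (S : {set T}) : S \in bases M -> #|S| = matroid_rank M.
Proof.
rewrite inE => /maxsetP[indS maxS]; apply/eqP; rewrite eqn_leq.
rewrite (@leq_bigmax_cond _ (indep M) (fun S : {set T} => #|S|) _ indS) /=.
case: (leqP (matroid_rank M) #|S|) => // ltS.
have [S0 indS0 E] : {S0 : {set T} | S0 \in indep M & matroid_rank M = #|S0|}.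
  apply: eq_bigmax_cond; apply/card_gt0P; exists set0; exact: indep0.
rewrite E in ltS; have [x] := indepX indS indS0 ltS.
rewrite inE => /andP[xS _] indx.
by have := maxS _ indx (subsetUr _ _) => /setP /(_ x); rewrite !inE eqxx (negPf xS).
Qed.

Lemma indep_rank_basis (S : {set T}) :
  indep M S -> #|S| = matroid_rank M -> S \in bases M.
Proof.
move=> indS cS; rewrite inE; apply/maxsetP; split=> // S' indS' sub.
apply/eqP; rewrite eq_sym eqEcard sub cS.
exact: (@leq_bigmax_cond _ (indep M) (fun S : {set T} => #|S|) _ indS').
Qed.

End Bases.

Section SetEnum.
Variables (m d : nat) (S : {set 'I_m}).
Hypothesis cardS : #|S| = d.

Definition setenum (i : 'I_d) : 'I_m := enum_val (cast_ord (esym cardS) i).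

Lemma setenum_inj : injective setenum.
Proof. by move=> i j /enum_val_inj /cast_ord_inj. Qed.

Lemma setenum_im : setenum @: setT = S.
Proof.
apply/eqP; rewrite eqEcard card_imset ?cardsT ?card_ord ?cardS ?leqnn ?andbT.
  by apply/subsetP => k /imsetP[i _ ->]; exact: enum_valP.
exact: setenum_inj.
Qed.

(** [totally_unimodular] speaks only of increasing index maps, so this monotonicity makes the
    columns of a basis an admissible minor. *)
Lemma setenum_homo : {homo setenum : i j / (i < j)%N}.
Proof.
move=> i j ij; rewrite /setenum.
have x0 : 'I_m := setenum i.
rewrite !(enum_val_nth x0) /=.
have srt : sorted (relpre val ltn) (enum S).
  rewrite /enum_mem; apply: sorted_filter; first by move=> a b c /=; apply: ltn_trans.
  by rewrite -enumT -sorted_map val_enum_ord iota_ltn_sorted.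
have tr : transitive (relpre (@nat_of_ord m) ltn) by move=> a b c /=; apply: ltn_trans.
by apply: (sorted_ltn_nth tr x0 srt) => //; rewrite inE -cardE cardS.
Qed.

End SetEnum.

Lemma det_principalE (R : realType) (m d : nat) (L : 'M[R]_m) (S : {set 'I_m})
    (cardS : #|S| = d) :
  \det (principal_submx L S) =
  \det (mxsub (setenum cardS) (setenum cardS) L).
Proof.
case: d / cardS; congr (\det _); apply/matrixP => i j.
by rewrite !mxE /setenum !cast_ord_id.
Qed.

Lemma det_principal_fact (R : realType) (m d : nat) (C : 'M[R]_(d, m))
    (H : 'M[R]_d) (S : {set 'I_m}) (cardS : #|S| = d) :
  \det (principal_submx (C^T *m H *m C) S) =
  \det H * \det (colsub (setenum cardS) C) ^+ 2.
Proof.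
rewrite (det_principalE _ cardS); set e := setenum cardS.
have -> : mxsub e e (C^T *m H *m C) = (colsub e C)^T *m H *m colsub e C.
  by rewrite mxsub_mul -mul_rowsub_mx -trmx_mxsub.
by rewrite !det_mulmx det_tr mulrAC mulrC expr2.
Qed.

(** A linear relation among the columns indexed by [S] is a vector in the left kernel of the
    transposed square submatrix. *)
Lemma free_cols_det (R : realType) (m d : nat) (B : 'M[R]_(d, m))
    (S : {set 'I_m}) (cardS : #|S| = d) :
  free [seq col i B | i <- enum S] = (\det (colsub (setenum cardS) B) != 0).
Proof.
rewrite -det_tr; case: d / cardS B => B.
set Q := (colsub _ B)^T.
have sz : size [seq col i B | i <- enum S] == #|S| by rewrite size_map cardE.
pose X := Tuple sz.
have lin (v : 'rV[R]_#|S|) : \sum_(i < #|S|) v 0 i *: X`_i = (v *m Q)^T.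
  apply/colP => a; rewrite summxE [RHS]mxE mxE; apply: eq_bigr => i _.
  rewrite !mxE (nth_map (enum_val i)) -?cardE ?ltn_ord // mxE.
  by rewrite /setenum cast_ord_id -enum_val_nth.
apply/idP/idP => [fX | dQ].
  apply/negP => /det0P[v v0 vQ]; case/negP: v0; apply/eqP/rowP => i.
  rewrite [RHS]mxE; have /freeP := fX : free X; apply.
  by rewrite lin vQ trmx0.
apply: (_ : free X); apply/freeP => k k0 i.
apply/eqP; apply: contraNT dQ => ki; apply/det0P.
exists (\row_j k j); first by apply: contraNneq ki => /rowP /(_ i); rewrite !mxE => ->.
apply: trmx_inj; rewrite -lin trmx0 -[RHS]k0.
by apply: eq_bigr => j _; rewrite mxE.
Qed.

Section Represented.
Variables (R : realType) (m d : nat) (B : 'M[R]_(d, m)) (M : matroid 'I_m).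
Hypotheses (repB : represents B M) (rankM : matroid_rank M = d).

Lemma basis_det (S : {set 'I_m}) (cardS : #|S| = d) :
  (S \in bases M) = (\det (colsub (setenum cardS) B) != 0).
Proof.
rewrite -free_cols_det -repB; apply/idP/idP => [|indS]; first by rewrite inE => /maxsetp.
by apply: indep_rank_basis => //; rewrite rankM.
Qed.

Lemma tu_basis_det (S : {set 'I_m}) (cardS : #|S| = d) :
  totally_unimodular B -> S \in bases M ->
  \det (colsub (setenum cardS) B) ^+ 2 = 1.
Proof.
move=> tuB; rewrite basis_det.
have := tuB d id (setenum cardS) (fun _ _ h => h) (@setenum_homo _ _ _ cardS).
by rewrite !inE => /or3P[] /eqP ->; rewrite ?sqrrN ?expr1n ?eqxx.
Qed.

End Represented.

(** * Anticoncentration on the integer grid *)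

Section SqrtSums.
Variable R : realType.
Implicit Types t u : R.

(** Discrete form of the fact that [2 sqrt u] has derivative [1 / sqrt u]: with [a = sqrt u] and
    [b = sqrt (u - 1)], [1 = (a - b)(a + b) <= 2 a (a - b)]. *)
Lemma isqrt_le_diff u : 1 <= u ->
  (Num.sqrt u)^-1 <= 2 * (Num.sqrt u - Num.sqrt (u - 1)).
Proof.
move=> u1; set a := Num.sqrt u; set b := Num.sqrt (u - 1).
have a0 : 0 < a by rewrite sqrtr_gt0; lra.
have b0 : 0 <= b by apply: sqrtr_ge0.
have a2 : a ^+ 2 = u by rewrite sqr_sqrtr //; lra.
have b2 : b ^+ 2 = u - 1 by rewrite sqr_sqrtr //; lra.
have ba : b <= a by apply: ler_wsqrtr; lra.
rewrite -div1r ler_pdivrMr //; nra.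
Qed.

Lemma sqrt_addn_le t (n : nat) : Num.sqrt (t + n%:R) <= Num.sqrt t + Num.sqrt n%:R.
Proof.
have n0 : 0 <= n%:R :> R by [].
have [t0|t0] := leP 0 t; last first.
  rewrite (ler0_sqrtr (ltW t0)) add0r; apply: ler_wsqrtr; lra.
rewrite -ler_sqr ?nnegrE ?addr_ge0 ?sqrtr_ge0 //.
rewrite sqrrD !sqr_sqrtr //; last by rewrite addr_ge0.
by rewrite -addrAC lerDl mulrn_wge0 // mulr_ge0 ?sqrtr_ge0.
Qed.

(** The differences of [isqrt_le_diff] telescope; they are nonnegative, so including the excluded
    indices does no harm, and subadditivity of the square root bounds what remains. *)
Lemma sum_isqrt_pos t (n : nat) :
  \sum_(v < n | 1 <= v%:R + t) (Num.sqrt (v%:R + t))^-1 <= 2 * Num.sqrt n%:R.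
Proof.
apply: le_trans (_ : \sum_(v < n)
    2 * (Num.sqrt (v.+1%:R + (t - 1)) - Num.sqrt (v%:R + (t - 1))) <= _).
  rewrite big_mkcond /=; apply: ler_sum => v _.
  have E : v.+1%:R + (t - 1) = v%:R + t by rewrite -natr1; lra.
  case: ifP => h; rewrite E.
    by have := isqrt_le_diff h; rewrite addrA.
  by rewrite mulr_ge0 // subr_ge0 ler_wsqrtr // addrA; lra.
rewrite -mulr_sumr ler_pM2l // -(big_mkord xpredT
  (fun v => Num.sqrt (v.+1%:R + (t - 1)) - Num.sqrt (v%:R + (t - 1)))).
rewrite telescope_sumr // lerBlDr add0r addrC [X in _ <= X]addrC.
exact: sqrt_addn_le.
Qed.

(** The indices with [v + t >= 0] are handled by [sum_isqrt_pos]; reversing the order of summation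
    turns those with [v + t < 0] into an instance of the same bound. *)
Lemma sum_isqrt_norm t (n : nat) :
  \sum_(v < n | 1 <= `|v%:R + t|) (Num.sqrt `|v%:R + t|)^-1 <= 4 * Num.sqrt n%:R.
Proof.
case: n => [|n]; first by rewrite big_ord0 mulr_ge0 ?sqrtr_ge0.
have -> : 4 * Num.sqrt n.+1%:R =
  2 * Num.sqrt n.+1%:R + 2 * Num.sqrt n.+1%:R :> R by lra.
apply: le_trans (lerD (sum_isqrt_pos t n.+1) (sum_isqrt_pos (- n%:R - t) n.+1)).
rewrite [X in _ <= _ + X](reindex_inj rev_ord_inj) /=.
rewrite [leLHS]big_mkcond [X in _ <= X + _]big_mkcond [X in _ <= _ + X]big_mkcond -big_split /=; apply: ler_sum => v _.
have -> : (n.+1 - v.+1)%:R + (- n%:R - t) = - (v%:R + t) :> R.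
  by rewrite subSS natrB; [lra | rewrite -ltnS].
set u := _ + t; have pos w : 0 <= (Num.sqrt w)^-1 :> R by rewrite invr_ge0 sqrtr_ge0.
case: (leP 0 u) => u0.
  rewrite ger0_norm //; case: ifP => _; case: ifP => _; rewrite ?addr0 ?lerDl ?add0r //.
rewrite ltr0_norm //.
by case: (1 <= u); case: ifP => _; rewrite ?addr0 ?lerDr ?add0r.
Qed.

(** These are the exceptional values: the integers in an open interval of length 2 are at most the
    least one and its successor. *)
Lemma count_near t (n : nat) : (#|[set v : 'I_n | (`|v%:R + t| < 1)%R]| <= 2)%N.
Proof.
set Z := [set v | _]; case: (pickP [in Z]) => [v1 v1Z | Z0]; last first.
  by rewrite eq_card0.
case: (arg_minnP (fun v : 'I_n => v : nat) v1Z) => v0 v0Z minv.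
(* If [v0.+1] is out of range, [insubd] falls back on [v0] and the set is a singleton. *)
apply: leq_trans (_ : #|[set v0; insubd v0 v0.+1]| <= 2)%N; last first.
  by rewrite cards2; case: (_ == _).
apply/subset_leq_card/subsetP => v vZ; rewrite !inE.
have v0v := minv v vZ.
have : (v < v0.+2)%N.
  have near (w : 'I_n) : w \in Z -> - 1 < w%:R + t /\ w%:R + t < 1.
    by rewrite inE ltr_norml => /andP.
  have [a b] := near v0 v0Z; have [c e] := near v vZ.
  rewrite -(ltr_nat R) -addn2 natrD; lra.
case: (eqVneq (v : nat) v0) => [/val_inj -> | ne lt2]; first by rewrite eqxx.
have E : v = v0.+1 :> nat by lia.
by apply/orP; right; apply/eqP/val_inj; rewrite val_insubd -E ltn_ord.
Qed.

End SqrtSums.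

(** * Coefficients of a multiaffine polynomial in part of its variables *)

Section Partial.
Variables (R : realType) (m : nat).
Implicit Types (x : {ffun 'I_m -> R}) (c : {set 'I_m} -> R) (U : {set 'I_m}).

(* The coefficient of the monomial [U], as a polynomial in the other variables. *)
Definition partial c U x : R :=
  \sum_(A : {set 'I_m} | U \subset A) c A * \prod_(k in A :\: U) x k.

Lemma partial0 c x : partial c set0 x = mpeval c x.
Proof.
by apply: eq_big => [A|A _]; rewrite ?sub0set // setD0.
Qed.

Lemma partial_top d c (S : {set 'I_m}) x : homog d c -> #|S| = d -> partial c S x = c S.
Proof.
move=> hc Sd; rewrite /partial (bigD1 S) ?subxx //= setDv big_set0 mulr1.
rewrite big1 ?addr0 // => A /andP[SA AS]; rewrite hc ?mul0r //.
apply: contraNneq AS => Ad; rewrite eq_sym eqEcard SA Ad Sd leqnn //.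
Qed.

Lemma partial_eq c U x x' : (forall k, k \notin U -> x k = x' k) ->
  partial c U x = partial c U x'.
Proof.
move=> h; apply: eq_bigr => A _; congr (_ * _); apply: eq_bigr => k.
by rewrite inE => /andP[/h].
Qed.

(** The polynomial has degree at most one in [x i]: monomials containing [i] give the slope, the
    others the value at [x i = 0]. *)
Lemma partial_del c U x i : i \in U ->
  partial c (U :\ i) x = x i * partial c U x + partial c (U :\ i) (xdel x i).
Proof.
move=> iU; rewrite /partial.
rewrite (bigID (fun A : {set 'I_m} => i \in A)) /=.
rewrite [X in _ = _ + X](bigID (fun A : {set 'I_m} => i \in A)) /=.
rewrite [X in _ = _ + (X + _)]big1 ?add0r; last first.
  move=> A /andP[_ iA]; rewrite (bigD1 i) /= ?ffunE ?eqxx ?mul0r ?mulr0 //.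
  by rewrite !inE eqxx iA.
congr (_ + _); last first.
  apply: eq_bigr => A /andP[_ iA]; congr (_ * _); apply: eq_bigr => k.
  by rewrite ffunE; case: eqP => // ->; rewrite inE (negPf iA) andbF.
rewrite mulr_sumr; apply: eq_big => [A | A /andP[_ iA]].
  apply/andP/idP => [[h iA] | h].
    apply/subsetP => k kU; case: (eqVneq k i) => [-> // | ki].
    by apply: (subsetP h); rewrite !inE ki.
  by split; [apply: subset_trans (subsetDl _ _) h | apply: (subsetP h)].
rewrite mulrCA; congr (_ * _); rewrite (bigD1 i) /=; last by rewrite !inE eqxx iA.
congr (_ * _); apply: eq_bigl => k; rewrite !inE.
by case: (eqVneq k i) => [-> | _]; rewrite ?iU ?andbF ?andbT //=.
Qed.

End Partial.

(** * Revealing the coordinates of a uniform grid point *)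

Section Grid.
Variables (R : realType) (m N : nat).
Hypothesis N_gt0 : (0 < N)%N.
Local Notation grid := {ffun 'I_m -> 'I_N}.
Implicit Types (x : grid) (c : {set 'I_m} -> R) (U S : {set 'I_m}).

Definition gridval x : {ffun 'I_m -> R} := [ffun i => (x i).+1%:R].

Definition gridset x (i : 'I_m) (v : 'I_N) : grid :=
  [ffun j => if j == i then v else x j].

(** Replacing one coordinate by a fresh uniform value preserves the uniform distribution. On pairs
    of a point and a fresh value, exchanging that value with coordinate [i] is an involution. *)
Lemma sum_resample (F : grid -> R) i :
  (\sum_x F x) * N%:R = \sum_x \sum_v F (gridset x i v).
Proof.
pose sw (p : grid * 'I_N) := (gridset p.1 i p.2, p.1 i).
have swK : involutive sw.
  case=> x v; congr pair; rewrite /= ?ffunE ?eqxx //.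
  by apply/ffunP => j; rewrite !ffunE; case: eqP => [->|].
rewrite pair_bigA /= [RHS](reindex_inj (inv_inj swK)) /=.
rewrite -(pair_bigA _ (fun x v => F (gridset (gridset x i v) i (x i)))) /=.
rewrite mulr_suml; apply: eq_bigr => x _.
rewrite (eq_bigr (fun _ => F x)) => [|v _]; last first.
  by congr F; apply/ffunP => j; rewrite !ffunE; case: eqP => [->|].
by rewrite sumr_const card_ord mulr_natr.
Qed.

Local Notation isq r := (Num.sqrt `|r|)^-1.

Lemma gridval_set c U x i v : i \in U ->
  partial c U (gridval (gridset x i v)) = partial c U (gridval x).
Proof.
move=> iU; apply: partial_eq => k kU; rewrite !ffunE.
by case: eqP => // ki; rewrite -ki (negPf kU) in iU.
Qed.

Lemma partial_resample c U x i v : i \in U ->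
  partial c (U :\ i) (gridval (gridset x i v)) =
  v.+1%:R * partial c U (gridval x) + partial c (U :\ i) (xdel (gridval x) i).
Proof.
move=> iU; rewrite (partial_del c _ iU) gridval_set //; congr (_ + _).
  by rewrite !ffunE eqxx.
by congr partial; apply/ffunP => k; rewrite !ffunE; case: eqP.
Qed.

(* [z] follows the partial coefficients as the variables of [S] are revealed
   one by one, and is stopped at [0] once their absolute value decreases. *)
Lemma partial_chain d c S U (j : nat) : homog d c -> #|S| = d -> c S != 0 ->
    U \subset S -> #|S :\: U| = j ->
  exists z : grid -> R,
    [/\ forall x, z x = 0 \/ z x = partial c U (gridval x),
        forall x i v, i \in U -> z (gridset x i v) = z x,
        (\sum_x (z x == 0)%:R) * N%:R <= (2 * j)%:R * N%:R ^+ m :> R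
      & (\sum_x isq (z x)) * Num.sqrt N%:R ^+ j <=
        isq (c S) * 4 ^+ j * N%:R ^+ m].
Proof.
move=> hc Sd cS0; elim: j U => [|j IH] U US cj.
  have -> : U = S.
    by apply/eqP; rewrite eqEsubset US /= -setD_eq0 -cards_eq0 cj.
  exists (fun=> c S); split.
  - by move=> x; right; rewrite (partial_top _ hc).
  - by [].
  - by rewrite (negPf cS0) big1 // mul0r muln0 mul0r.
  - by rewrite sumr_const card_ffun !card_ord !expr0 !mulr1 -[_ *+ (N ^ m)]mulr_natr natrX.
have [i iSU] : exists i, i \in S :\: U by apply/card_gt0P; rewrite cj.
move: (iSU); rewrite inE => /andP[iU iS].
have UE : (i |: U) :\ i = U.
  by apply/setP => k; rewrite !inE; case: eqVneq => [->|//]; rewrite (negPf iU).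
have iV : i \in i |: U by rewrite !inE eqxx.
have [||z [zE zi zbad zw]] := IH (i |: U).
  by rewrite subUset sub1set iS.
  have -> : S :\: (i |: U) = (S :\: U) :\ i.
    by apply/setP => k; rewrite !inE negb_or; case: (k == i); rewrite ?andbF.
  by move: cj; rewrite (cardsD1 i) iSU add1n => -[].
(* As a function of the new coordinate the next coefficient is affine with slope [z x]; dividing by
   the slope reduces it to [v + t]. *)
have pE x v : z x != 0 ->
  partial c U (gridval (gridset x i v)) =
  (v%:R + (1 + partial c U (xdel (gridval x) i) / z x)) * z x.
  move=> zx; rewrite -{1}UE partial_resample // UE.
  case: (zE x) => [e | <-]; first by rewrite e eqxx in zx.
  by rewrite -natr1; field.
(* A path goes on if it was not stopped before and the absolute value did not just decrease. *)
pose good x := (z x != 0) && (`|z x| <= `|partial c U (gridval x)|).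
exists (fun x => if good x then partial c U (gridval x) else 0); split.
- by move=> x; case: (good x); [right | left].
- move=> x k v kU; rewrite /good gridval_set // zi // inE kU orbT //.
- have bad x : ((if good x then partial c U (gridval x) else 0) == 0)%:R <=
      (z x == 0)%:R +
      ((z x != 0) && (`|partial c U (gridval x)| < `|z x|))%:R :> R.
    rewrite /good; case: (eqVneq (z x) 0) => [-> /=|zx /=]; first by rewrite ?eqxx lerDl ler0n.
    rewrite [`|z x| <= _]leNgt; case: ltP => h /=; first by rewrite ?eqxx lerDr ler0n.
    rewrite (negPf (_ : _ != 0)) ?addr0 // -normr_gt0.
    by apply: lt_le_trans h; rewrite normr_gt0.
  apply: le_trans (_ : (\sum_x (z x == 0)%:R + \sum_x ((z x != 0) &&
    (`|partial c U (gridval x)| < `|z x|))%:R) * N%:R <= _).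
    by rewrite -big_split /= ler_wpM2r //; apply: ler_sum => x _; exact: bad.
  (* With coordinate [i] resampled and the rest fixed, at most two values [v] newly stop the path,
     by [count_near]; this adds 2 to [2 * j]. *)
  rewrite mulrDl mulnSr natrD mulrDl lerD // (sum_resample _ i).
  have -> : 2 * N%:R ^+ m = \sum_(x : grid) 2 :> R.
    by rewrite sumr_const card_ffun !card_ord -[_ *+ (N ^ m)]mulr_natr natrX.
  apply: ler_sum => x _.
  case: (eqVneq (z x) 0) => [z0 | zx].
    by rewrite big1 // => v _; rewrite zi // z0 eqxx.
  apply: le_trans (_ : (#|[set v : 'I_N |
    (`|v%:R + (1 + partial c U (xdel (gridval x) i) / z x)| < 1)%R]|)%:R <= _);
    last by rewrite ler_nat count_near.
  rewrite -sum1_card natr_sum [leRHS]big_mkcond; apply: ler_sum => v _.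
  rewrite zi // zx /= pE // normrM gtr_pMl ?normr_gt0 // inE.
  by case: ifP.
- have Ns : N%:R = Num.sqrt N%:R ^+ 2 :> R by rewrite sqr_sqrtr.
  have sN : 0 < Num.sqrt N%:R :> R by rewrite sqrtr_gt0 ltr0n.
  pose z' x := if good x then partial c U (gridval x) else 0.
  (* Stopped paths contribute 0, since the inverse of 0 is 0. On the others [|v + t| >= 1], so by
     [sum_isqrt_norm] averaging over [v] multiplies [isq (z x)] by at most [4 / sqrt N]. *)
  have key : (\sum_x isq (z' x)) * Num.sqrt N%:R <=
      4 * \sum_x isq (z x).
    rewrite -(ler_pM2r sN) -mulrA -expr2 -Ns (sum_resample _ i).
    rewrite mulrAC mulr_sumr; apply: ler_sum => x _.
    case: (eqVneq (z x) 0) => [z0 | zx].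
      rewrite big1 => [|v _]; first by rewrite mulr_ge0 ?mulr_ge0 ?invr_ge0 ?sqrtr_ge0.
      by rewrite /z' /good zi // z0 eqxx normr0 sqrtr0 invr0.
    rewrite -[leRHS]mulrC.
    apply: le_trans (ler_wpM2l _ (sum_isqrt_norm
      (1 + partial c U (xdel (gridval x) i) / z x) N)); last first.
      by rewrite invr_ge0 sqrtr_ge0.
    rewrite mulr_sumr [leRHS]big_mkcond /=; apply: ler_sum => v _.
    rewrite /z' /good zi // zx /= pE // normrM ler_pMl ?normr_gt0 //.
    case: ifP => _; last by rewrite normr0 sqrtr0 invr0.
    by rewrite normrM sqrtrM // invfM mulrC.
  rewrite -/z' exprS mulrA; apply: le_trans (_ : 4 * (\sum_x isq (z x)) *
    Num.sqrt N%:R ^+ j <= _).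
    by apply: ler_wpM2r key; rewrite exprn_ge0 // ltW.
  have -> : isq (c S) * 4 ^+ j.+1 * N%:R ^+ m = 4 * (isq (c S) * 4 ^+ j * N%:R ^+ m).
    by rewrite exprS; ring.
  by rewrite -mulrA ler_pM2l.
Qed.

(** Stopped points make up a fraction of at most [2 d / N <= 1/4]. For the others apply Markov's
    inequality to [isq]: with [256 = 16 ^ 2], the bound [(4 / sqrt N) ^ d] times [(sqrt N / 16) ^ d]
    is [(1/4) ^ d], which is at most [1/4] because [d > 0]. *)
Lemma anticoncentration d c S : homog d c -> #|S| = d -> (0 < d)%N ->
    (8 * d <= N)%N ->
  (2 * #|[set x : grid | `|mpeval c (gridval x)| < `|c S| * (N%:R / 256) ^+ d]%R|
   <= N ^ m)%N.
Proof.
move=> hc Sd d0 dN; set r := `|c S| * _; set X := [set x | _].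
case: (eqVneq (c S) 0) => [c0 | cS0].
  rewrite eq_card0 ?muln0 // => x; rewrite !inE /r c0 normr0 mul0r.
  by rewrite ltNge normr_ge0.
have [z [zE _ zbad zw]] := @partial_chain d c S set0 d hc Sd cS0 (sub0set _)
  (etrans (congr1 (fun Z : {set 'I_m} => #|Z|) (setD0 S)) Sd).
have sN : 0 < Num.sqrt N%:R :> R by rewrite sqrtr_gt0 ltr0n.
have Ngt0 : 0 < N%:R :> R by rewrite ltr0n.
have r0 : 0 <= r by rewrite mulr_ge0 // exprn_ge0 // divr_ge0.
have XE : #|X|%:R <= \sum_x (z x == 0)%:R + Num.sqrt r * \sum_x isq (z x).
  rewrite -sum1_card natr_sum big_mkcond mulr_sumr -big_split /=.
  apply: ler_sum => x _; case: ifP => [|_]; last first.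
    by rewrite addr_ge0 // mulr_ge0 ?invr_ge0 ?sqrtr_ge0.
  rewrite inE => gx; case: (eqVneq (z x) 0) => [-> | zx] /=.
    by rewrite lerDl mulr_ge0 ?invr_ge0 ?sqrtr_ge0.
  have zg : z x = mpeval c (gridval x).
    by case: (zE x) => [e|->]; [rewrite e eqxx in zx | rewrite partial0].
  rewrite add0r ler_pdivlMr ?sqrtr_gt0 ?normr_gt0 // mul1r.
  by apply: ler_wsqrtr; rewrite zg ltW.
have b1 : \sum_x (z x == 0)%:R <= N%:R ^+ m / 4 :> R.
  rewrite -(ler_pM2r Ngt0); apply: le_trans zbad _.
  rewrite [leRHS]mulrAC mulrC -mulrA ler_pM2l ?exprn_gt0 // ler_pdivlMr //.
  by rewrite -natrM ler_nat; lia.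
have b2 : Num.sqrt r * \sum_x isq (z x) <= N%:R ^+ m / 4.
  have -> : Num.sqrt r = Num.sqrt `|c S| * (Num.sqrt N%:R / 16) ^+ d.
    rewrite /r sqrtrM //; congr (_ * _).
    have -> : N%:R / 256 = (Num.sqrt N%:R / 16) ^+ 2 :> R.
      by rewrite expr_div_n sqr_sqrtr //; congr (_ / _); ring.
    by rewrite exprAC sqrtr_sqr ger0_norm // exprn_ge0 // divr_ge0 // ltW.
  have : Num.sqrt `|c S| * ((\sum_x isq (z x)) * Num.sqrt N%:R ^+ d) <=
    4 ^+ d * N%:R ^+ m.
    rewrite [leLHS]mulrC -ler_pdivlMr ?sqrtr_gt0 ?normr_gt0 //.
    by apply: le_trans zw _; rewrite [leRHS]mulrC mulrA.
  have p16 : 0 < 16 ^+ d :> R by rewrite exprn_gt0.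
  rewrite expr_div_n => h; rewrite -(ler_pM2r p16).
  set K := \sum_x _ in h *; set Q := Num.sqrt N%:R ^+ d in h *.
  have -> : Num.sqrt `|c S| * (Q / 16 ^+ d) * K * 16 ^+ d =
    Num.sqrt `|c S| * (K * Q) by field; rewrite gt_eqF.
  apply: le_trans h _; rewrite mulrC -[leRHS]mulrA ler_pM2l ?exprn_gt0 //.
  rewrite mulrC ler_pdivlMr //.
  have -> : 16 = 4 * 4 :> R by ring.
  rewrite exprMn ler_pM2l ?exprn_gt0 //.
  by rewrite -{1}(expr1 4) ler_eXn2l // ltr1n.
have : #|X|%:R <= N%:R ^+ m / 2 :> R by lra.
rewrite ler_pdivlMr // mulrC => h.
by rewrite -(ler_nat R) natrM natrX.
Qed.

End Grid.

(** * Timed weakest preconditions *)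

(** Syntactic write sets over-approximate what a command can change; frame conditions for all
    programs below are read off from them. *)
Fixpoint wregs (c : cmd) : seq nat :=
  match c with
  | NSet x _ | Flip x => [:: x]
  | Seq c1 c2 | If _ c1 c2 => wregs c1 ++ wregs c2
  | While _ c1 => wregs c1
  | _ => [::]
  end.

Fixpoint warrs (c : cmd) : seq nat :=
  match c with
  | RSet a _ _ _ => [:: a]
  | Seq c1 c2 | If _ c1 c2 => warrs c1 ++ warrs c2
  | While _ c1 => warrs c1
  | _ => [::]
  end.

Fixpoint flipfree (c : cmd) : bool :=
  match c with
  | Flip _ => false
  | Seq c1 c2 | If _ c1 c2 => flipfree c1 && flipfree c2
  | While _ c1 => flipfree c1
  | _ => true
  end.

(* Running time when every loop makes at most [M] iterations. *)
Fixpoint cost (M : nat) (c : cmd) : nat :=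
  match c with
  | Seq c1 c2 | If _ c1 c2 => (cost M c1 + cost M c2).+1
  | While _ c1 => (M * (cost M c1).+1).+1
  | _ => 1
  end.

Definition For (x : nat) (e : nexp) (body : cmd) : cmd :=
  Seq (NSet x (NCst 0))
    (While (TNot (TNLe e (NReg x)))
      (Seq body (NSet x (NAdd (NReg x) (NCst 1))))).

Section Hoare.
Variables (R : realType) (M : nat).
Implicit Types (s : state R) (c : cmd) (Q : state R -> Prop).

Definition frame (ws ars : seq nat) s s' : Prop :=
  (forall r, r \notin ws -> nreg s' r = nreg s r) /\
  (forall a, a \notin ars -> rarr s' a = rarr s a).

(** Quantifying over the continuation [k] makes executions compose: the number of steps does not
    depend on what is left on the stack. *)
Definition runs c n s s' : Prop :=
  exists2 t, (t <= n)%N & forall k, iter t (@step R) (c :: k, s) = (k, s').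

Definition wp c s Q : Prop := exists2 s', runs c (cost M c) s s' & Q s'.

(** The common induction behind the three frame facts, on registers, arrays and coins: [ok] is a
    syntactic condition inherited by every command pushed on the stack, and it prevents any change
    of [obs]. *)
Lemma iter_step_obs (X : Type) (ok : cmd -> bool) (obs : state R -> X) :
  (forall st s, all ok st ->
    all ok (step (st, s)).1 /\ obs (step (st, s)).2 = obs s) ->
  forall t st s, all ok st -> obs (iter t (@step R) (st, s)).2 = obs s.
Proof.
move=> pres; elim=> [//|t IH] st s okst; rewrite iterSr.
have [ok' <-] := pres st s okst.
by case: (step (st, s)) ok' => st' s' /= ok'; exact: IH.
Qed.

Lemma runs_obs (X : Type) (ok : cmd -> bool) (obs : state R -> X) c n s s' :
  (forall st s, all ok st ->
    all ok (step (st, s)).1 /\ obs (step (st, s)).2 = obs s) ->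
  ok c -> runs c n s s' -> obs s' = obs s.
Proof.
move=> pres okc [t _ /(_ [::]) E].
by have := iter_step_obs pres t s (st := [:: c]); rewrite E /= okc; apply.
Qed.

Lemma runs_frame c n s s' : runs c n s s' -> frame (wregs c) (warrs c) s s'.
Proof.
move=> h; split=> [r | a] nin.
  apply: (@runs_obs nat (fun c => r \notin wregs c) (fun s => nreg s r) c n s s') => //.
  move=> [|[|x e|a i j e|x|c1 c2|b c1 c2|b c1] st] s1 //= /andP[]; rewrite ?mem_cat ?inE ?negb_or.
  - by move=> /negPf rx ->; rewrite /upd rx.
  - by move=> /negPf rx ->; rewrite /upd rx.
  - by move=> /andP[-> ->] ->.
  - by case: teval => /andP[h1 h2] ->; rewrite ?h1 ?h2.
  - by case: teval => h1 /=; rewrite ?h1.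
apply: (@runs_obs _ (fun c => a \notin warrs c) (fun s => rarr s a) c n s s') => //.
move=> [|[|x e|a' i j e|x|c1 c2|b c1 c2|b c1] st] s1 //= /andP[]; rewrite ?mem_cat ?inE ?negb_or.
- by move=> /negPf rx ->; rewrite /upd rx.
- by move=> /andP[-> ->] ->.
- by case: teval => /andP[h1 h2] ->; rewrite ?h1 ?h2.
- by case: teval => h1 /=; rewrite ?h1.
Qed.

Lemma runs_coins c n s s' : flipfree c -> runs c n s s' -> coins s' = coins s.
Proof.
apply: (@runs_obs _ flipfree (@coins R)).
move=> [|[|x e|a i j e|x|c1 c2|b c1 c2|b c1] st] s1 //= /andP[].
- by move=> /andP[-> ->] ->.
- by case: teval => /andP[h1 h2] ->; rewrite ?h1 ?h2.
- by case: teval => h1 /=; rewrite ?h1.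
Qed.

Lemma frame_trans ws ars s1 s2 s3 :
  frame ws ars s1 s2 -> frame ws ars s2 s3 -> frame ws ars s1 s3.
Proof.
move=> [r12 a12] [r23 a23]; split=> [r h | a h]; first by rewrite r23 ?r12.
by rewrite a23 ?a12.
Qed.

Lemma frame_sub ws ars ws' ars' s1 s2 : {subset ws <= ws'} ->
  {subset ars <= ars'} -> frame ws ars s1 s2 -> frame ws' ars' s1 s2.
Proof.
move=> sw sa [r12 a12]; split=> [r h | a h].
  by apply: r12; apply: contra h; apply: sw.
by apply: a12; apply: contra h; apply: sa.
Qed.

(** The consequence rule, which also hands over the frame and, without flips, the unchanged tape;
    postconditions can then mention only what changes. *)
Lemma wp_mono c s Q Q' : wp c s Q ->
  (forall s', frame (wregs c) (warrs c) s s' ->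
     (flipfree c -> coins s' = coins s) -> Q s' -> Q' s') ->
  wp c s Q'.
Proof.
case=> s' run qs' QQ'; exists s' => //; apply: QQ' => //; first exact: runs_frame run.
by move=> ff; apply: runs_coins run.
Qed.

Lemma wp_skip s Q : Q s -> wp Skip s Q.
Proof. by move=> q; exists s => //; exists 1%N. Qed.

Lemma wp_nset x e s Q : Q (set_nreg s x (neval s e)) -> wp (NSet x e) s Q.
Proof. by move=> q; exists (set_nreg s x (neval s e)) => //; exists 1%N. Qed.

Lemma wp_rset a i j e s Q :
    (forall s', nreg s' = nreg s -> coins s' = coins s ->
       (forall b, b != a -> rarr s' b = rarr s b) ->
       (forall i' j', rarr s' a i' j' =
          if (i' == neval s i) && (j' == neval s j) then reval s e
          else rarr s a i' j') ->
       Q s') ->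
  wp (RSet a i j e) s Q.
Proof.
move=> q; exists (set_rarr s a (neval s i) (neval s j) (reval s e)).
  by exists 1%N.
apply: q => //= [b /negPf ba | i' j']; first by rewrite /upd ba.
by rewrite /upd eqxx; case: eqP => [->|//]; case: eqP => [->|].
Qed.

Lemma wp_flip x s Q : Q (flip s x) -> wp (Flip x) s Q.
Proof. by move=> q; exists (flip s x) => //; exists 1%N. Qed.

Lemma wp_seq c1 c2 s Q :
  wp c1 s (fun s1 => wp c2 s1 Q) -> wp (Seq c1 c2) s Q.
Proof.
case=> s1 [t1 le1 E1] [s2 [t2 le2 E2] q]; exists s2 => //.
exists (t2 + t1).+1%N => [|k]; first by rewrite ltnS addnC leq_add.
by rewrite iterSr iterD /= E1 E2.
Qed.

Lemma wp_if t c1 c2 s Q :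
  (teval s t -> wp c1 s Q) -> (~~ teval s t -> wp c2 s Q) ->
  wp (If t c1 c2) s Q.
Proof.
move=> h1 h2; case E: (teval s t).
  have [s' [u le1 E1] q] := h1 E; exists s' => //; exists u.+1 => [|k].
    by rewrite ltnS (leq_trans le1) ?leq_addr.
  by rewrite iterSr /= E E1.
have [|s' [u le1 E1] q] := h2; first by rewrite E.
exists s' => //; exists u.+1 => [|k].
  by rewrite ltnS (leq_trans le1) ?leq_addl.
by rewrite iterSr /= E E1.
Qed.

(** The bound [e] is evaluated again at each test, so it must be stable under everything the loop
    may write; the invariant must not see the counter register. *)
Lemma wp_for x e body n s0 (I : nat -> state R -> Prop) :
    (n <= M)%N -> x \notin wregs body ->
    (forall s, frame (x :: wregs body) (warrs body) s0 s -> neval s e = n) ->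
    (forall j s v, I j s -> I j (set_nreg s x v)) ->
    I 0%N s0 ->
    (forall j s, (j < n)%N -> nreg s x = j ->
       frame (x :: wregs body) (warrs body) s0 s -> I j s ->
       wp body s (I j.+1)) ->
  wp (For x e body) s0 (I n).
Proof.
move=> nM xw en Ireg I0 Istep; set tb := cost M body.
rewrite /For; set W := While _ _.
(* An iteration costs three steps besides the body (test, unfolding of [Seq], increment); the last
   unit is the failing test. *)
have loop k j s :  (k + j = n)%N -> nreg s x = j ->
    frame (x :: wregs body) (warrs body) s0 s -> I j s ->
    exists2 s', runs W (k * (tb + 3) + 1) s s' & I n s'.
  elim: k j s => [|k IH] j s kj sx fr Ij.
    exists s; last by rewrite -kj.
    exists 1%N => // st; rewrite /= en // sx -kj leqnn.
    by [].
  have jn : (j < n)%N by rewrite -kj addSn ltnS leq_addl.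
  have [s1 run1 Ij1] := Istep j s jn sx fr Ij.
  have fr1 := runs_frame run1; pose s2 := set_nreg s1 x j.+1.
  have sx1 : nreg s1 x = j by rewrite fr1.1.
  have fr2 : frame (x :: wregs body) (warrs body) s0 s2.
    apply: frame_trans fr _; split=> [r | a ha]; last exact: fr1.2.
    by rewrite inE negb_or => /andP[/negPf rx rw]; rewrite /= /upd rx fr1.1.
  have [||||s3 [t3 le3 E3] q] := IH j.+1 s2.
  - by rewrite addnS -addSn.
  - by rewrite /= /upd eqxx.
  - by [].
  - exact: Ireg.
  exists s3 => //; case: run1 => t1 le1 E1.
  exists (t3 + (1 + (t1 + 2)))%N; first by rewrite mulSn; lia.
  move=> st; rewrite iterD iterD iterD /= en // sx leqNgt jn /= E1.
  rewrite /= sx1 addn1; exact: E3.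
have [||||s1 [t1 le1 E1] q] := loop n 0%N (set_nreg s0 x 0).
- by rewrite addn0.
- by rewrite /= /upd eqxx.
- split=> // r; rewrite inE negb_or => /andP[/negPf rx _].
  by rewrite /= /upd rx.
- exact: Ireg.
exists s1 => //; exists (t1 + 2)%N.
  have : (n * (tb + 3) <= M * (tb + 3))%N by rewrite leq_mul2r nM orbT.
  by rewrite /= -/tb; lia.
by move=> st; rewrite iterD /= E1.
Qed.

End Hoare.

(** * The algorithm *)

Definition sget (a : nat) : rexp := RGet a (NCst 0) (NCst 0).
Definition sset (a : nat) (e : rexp) : cmd := RSet a (NCst 0) (NCst 0) e.

(* Register 0 holds m, register 1 holds d.  Array 1 is B, 2 the output, 3 the
   working copy of the form, 4 the vector A y, 6 the weights x, 7 the identity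
   matrix; arrays 8 to 12 hold scalars: pivot, determinant, best determinant of
   a deletion, saved weight, best determinant over the trials. *)

Definition map2_cmd (e : rexp) : cmd :=
  For 11 (NReg 0) (For 12 (NReg 0) (RSet 3 (NReg 11) (NReg 12) e)).

Definition row_cmd : cmd :=
  Seq (RSet 4 (NReg 11) (NCst 0) (RCst 0))
  (Seq (For 12 (NReg 0)
         (RSet 4 (NReg 11) (NCst 0)
           (RAdd (RGet 4 (NReg 11) (NCst 0))
             (RMul (RGet 3 (NReg 11) (NReg 12))
               (RMul (RGet 1 (NReg 10) (NReg 12)) (RGet 6 (NReg 12) (NCst 0)))))))
       (sset 8 (RAdd (sget 8)
         (RMul (RMul (RGet 1 (NReg 10) (NReg 11)) (RGet 6 (NReg 11) (NCst 0)))
               (RGet 4 (NReg 11) (NCst 0)))))).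

Definition schur_exp : rexp :=
  RSub (RGet 3 (NReg 11) (NReg 12))
    (RMul (RDiv (RCst 1) (sget 8))
      (RMul (RGet 4 (NReg 11) (NCst 0)) (RGet 4 (NReg 12) (NCst 0)))).

Definition pivot_cmd : cmd :=
  Seq (sset 8 (RCst 0))
  (Seq (For 11 (NReg 0) row_cmd)
  (Seq (map2_cmd schur_exp)
       (sset 9 (RMul (sget 9) (sget 8))))).

Definition det_cmd (src : nat) : cmd :=
  Seq (map2_cmd (RGet src (NReg 11) (NReg 12)))
  (Seq (sset 9 (RCst 1))
       (For 10 (NReg 1) pivot_cmd)).

(** * Correctness of the determinant routine *)

Section DetCmd.
Variables (R : realType) (M m d : nat) (B : 'M[R]_(d, m)).
Hypotheses (mM : (m <= M)%N) (dM : (d <= M)%N).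
Implicit Types (s : state R) (A : 'M[R]_m).

Definition inputs s : Prop :=
  [/\ nreg s 0 = m, nreg s 1 = d & forall i j, rarr s 1 i j = mx_array B i j].

Definition holds (a : nat) A s : Prop := forall i j : 'I_m, rarr s a i j = A i j.

Definition weights s : {ffun 'I_m -> R} := [ffun i : 'I_m => rarr s 6 i 0%N].

(** The update is in place: [e] may read the entry of array 3 about to be overwritten, which still
    has its old value, and everything outside array 3. *)
Lemma wp_map2 e (F : nat -> nat -> R) s0 : nreg s0 0 = m ->
    (forall i l s, (i < m)%N -> (l < m)%N -> nreg s 11 = i -> nreg s 12 = l ->
       frame [:: 11; 12] [:: 3] s0 s -> rarr s 3 i l = rarr s0 3 i l ->
       reval s e = F i l) ->
  wp M (map2_cmd e) s0 (fun s => forall i l, (i < m)%N -> (l < m)%N ->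
    rarr s 3 i l = F i l).
Proof.
move=> m0 Fe.
pose I1 j s := (forall i l, (i < j)%N -> (l < m)%N -> rarr s 3 i l = F i l) /\
  (forall i l, (j <= i)%N -> rarr s 3 i l = rarr s0 3 i l).
apply: (@wp_mono _ _ _ _ (I1 m)); last first.
  by move=> s' _ _ [h _] i l im lm; apply: h.
apply: wp_for => //; first by move=> s fr; rewrite /= fr.1 //.
move=> j s jm sj fr [Ij1 Ij2].
pose I2 l0 s1 := (forall i l, (i < j)%N -> (l < m)%N -> rarr s1 3 i l = F i l) /\
  ((forall i l, (j < i)%N -> rarr s1 3 i l = rarr s0 3 i l) /\
  ((forall l, (l < l0)%N -> rarr s1 3 j l = F j l) /\
   (forall l, (l0 <= l)%N -> rarr s1 3 j l = rarr s0 3 j l))).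
apply: (@wp_mono _ _ _ _ (I2 m)); last first.
  move=> s' _ _ [h1 [h2 [h3 _]]]; split=> i l ij; last exact: h2.
  by move: ij; rewrite ltnS leq_eqVlt => /orP[/eqP -> | ij] lm; [apply: h3 | apply: h1].
apply: wp_for => //; first by move=> s1 fr1; rewrite /= fr1.1 // fr.1.
  split; first exact: Ij1.
  by split=> [i l ij|]; [apply: Ij2; apply: ltnW | split=> // l _; apply: Ij2].
move=> l0 s1 lm s1l fr1 [h1 [h2 [h3 h4]]]; apply: wp_rset => s2 _ _ _.
have s1j : nreg s1 11 = j by rewrite fr1.1.
have -> : reval s1 e = F j l0.
  apply: Fe => //; last exact: h4.
  apply: frame_trans (frame_sub _ _ fr) (frame_sub _ _ fr1).
  - by apply/allP.
  - by apply/allP.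
  - by apply/allP.
  - by apply/allP.
rewrite /= s1j s1l => E; split.
  by move=> i l ij lm'; rewrite E ltn_eqF //= h1.
split; first by move=> i l ij; rewrite E gtn_eqF //= h2.
split=> l ll; rewrite E eqxx /=.
  case: eqP => [->//|/eqP ne]; apply: h3.
  by rewrite ltn_neqAle ne -ltnS.
by rewrite gtn_eqF // h4 // ltnW.
Qed.

Definition brow s (j : nat) : 'rV[R]_m := \row_l (mx_array B j l * weights s l).

Lemma wp_row j i A s : (i < m)%N -> inputs s -> nreg s 10 = j -> nreg s 11 = i ->
    holds 3 A s ->
  wp M row_cmd s (fun s' =>
    [/\ forall i', i' != i -> rarr s' 4 i' 0 = rarr s 4 i' 0,
        forall i0 : 'I_m, i0 = i :> nat ->
          rarr s' 4 i 0 = \sum_l A i0 l * brow s j 0 l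
      & forall i0 : 'I_m, i0 = i :> nat ->
          rarr s' 8 0 0 = rarr s 8 0 0 + brow s j 0 i0 * rarr s' 4 i 0]).
Proof.
move=> im [sm sd sB] sj si sA.
apply: wp_seq; apply: wp_rset => s1 n1 _ o1 E1; rewrite /= si in E1.
apply: wp_seq.
pose I l s2 := (forall i', i' != i -> rarr s2 4 i' 0 = rarr s 4 i' 0) /\
  (forall i0 : 'I_m, i0 = i :> nat ->
    rarr s2 4 i 0 = \sum_(l0 < m | (l0 < l)%N) A i0 l0 * brow s j 0 l0).
apply: (@wp_mono _ _ _ _ (I m)).
  apply: wp_for => //.
  - by move=> s2 fr; rewrite /= fr.1 // n1.
  - split=> [i' ni | i0 _]; rewrite E1 ?eqxx ?(negPf ni) //=.
    by rewrite big_pred0.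
  move=> l s2 lm s2l fr [h1 h2]; apply: wp_rset => s3 _ _ _.
  rewrite /= s2l (fr.1 11) // n1 si => E3.
  split=> [i' ni | i0 ii]; first by rewrite E3 (negPf ni) /= h1.
  rewrite E3 !eqxx /= (h2 _ ii) (fr.2 3) // (fr.2 1) // (fr.2 6) // (fr.1 10) //.
  rewrite n1 !o1 // sj -ii (sA i0 (Ordinal lm)).
  rewrite [RHS](bigD1 (Ordinal lm)) //= [RHS]addrC; congr (_ + _).
    by apply: eq_bigl => l0; rewrite ltnS andbC ltn_neqAle.
  by rewrite /brow !mxE ffunE /= sB.
move=> s2 fr _ [h1 h2]; apply: wp_rset => s3 _ _ o3.
rewrite /= (fr.1 11) // (fr.1 10) // n1 si sj => E3.
split=> [i' ni | i0 ii | i0 ii]; first by rewrite o3 // h1.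
  by rewrite o3 // (h2 _ ii); apply: eq_bigl => l; rewrite ltn_ord.
rewrite E3 /= o3 // (fr.2 8) // (fr.2 1) // (fr.2 6) // !o1 //.
by congr (_ + _); congr (_ * _); rewrite /brow !mxE ffunE sB ii.
Qed.

Lemma mx_arrayE (n n' : nat) (A : 'M[R]_(n, n')) (i : 'I_n) (j : 'I_n') :
  mx_array A i j = A i j.
Proof. by rewrite /mx_array !valK. Qed.

Lemma brow_eq s s' j : rarr s' 6 = rarr s 6 -> brow s' j = brow s j.
Proof. by move=> E; apply/rowP => l; rewrite !mxE !ffunE E. Qed.

Lemma inputs_frame s s' : inputs s -> nreg s' 0 = nreg s 0 ->
  nreg s' 1 = nreg s 1 -> rarr s' 1 = rarr s 1 -> inputs s'.
Proof. by case=> sm sd sB e0 e1 eB; split; rewrite ?e0 ?e1 ?eB. Qed.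

Lemma wp_pivot j A s : inputs s -> nreg s 10 = j -> holds 3 A s -> psdmx A ->
  wp M pivot_cmd s (fun s' =>
    holds 3 (schur A (brow s j)) s' /\
    rarr s' 9 0 0 = rarr s 9 0 0 * form A (brow s j) (brow s j)).
Proof.
move=> ins sj sA psdA; have symA := psdA.1; set y := brow s j.
(* The program sums along the rows of [A]; by symmetry the result is [y *m A]. *)
have yA (i0 : 'I_m) : (y *m A) 0 i0 = \sum_l A i0 l * y 0 l.
  rewrite [LHS]mxE; apply: eq_bigr => l _; rewrite mulrC; congr (_ * _).
  by rewrite -[in LHS]symA mxE.
apply: wp_seq; apply: wp_rset => s1 n1 _ o1 E1; rewrite /= in E1.
pose I i s2 := (forall i0 : 'I_m, (i0 < i)%N -> rarr s2 4 i0 0 = (y *m A) 0 i0) /\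
  rarr s2 8 0 0 = \sum_(i0 < m | (i0 < i)%N) y 0 i0 * (y *m A) 0 i0.
apply: wp_seq; apply: (@wp_mono _ _ _ _ (I m)).
  apply: wp_for => //.
  - by move=> s2 fr; rewrite /= fr.1 // n1; case: ins.
  - by split=> //; rewrite E1 big_pred0.
  move=> i s2 im s2i fr [h1 h2].
  have b2 : brow s2 j = y by apply: brow_eq; rewrite (fr.2 6) // o1.
  have in2 : inputs s2.
    by apply: (inputs_frame ins); rewrite ?(fr.1 0) ?(fr.1 1) ?(fr.2 1) ?n1 ?o1.
  have sj2 : nreg s2 10 = j by rewrite (fr.1 10) // n1.
  have A2 : holds 3 A s2 by move=> a b; rewrite (fr.2 3) // o1 // sA.
  apply: (wp_mono (wp_row im in2 sj2 s2i A2)) => s3 fr3 _ [g1 g2 g3].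
  have {}g2 := g2 (Ordinal im) erefl; have {}g3 := g3 (Ordinal im) erefl.
  have w3 : rarr s3 4 i 0 = (y *m A) 0 (Ordinal im) by rewrite g2 b2 yA.
  split=> [i0 | ].
    rewrite ltnS leq_eqVlt => /orP[/eqP e | lt]; last first.
      by rewrite g1 ?h1 // ltn_eqF.
    by rewrite e w3; congr (_ _ _); apply: val_inj.
  rewrite g3 h2 b2 w3 [RHS](bigD1 (Ordinal im)) //= [RHS]addrC; congr (_ + _).
  by apply: eq_bigl => l0; rewrite ltnS andbC ltn_neqAle.
move=> s2 fr _ [h1 h2].
have al : rarr s2 8 0 0 = form A y y.
  rewrite h2 /form mxE (eq_bigl xpredT) => [|i]; last by rewrite ltn_ord.
  by apply: eq_bigr => i _; rewrite [y^T _ _]mxE mulrC.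
apply: wp_seq; apply: wp_mono.
  apply: (@wp_map2 _ (mx_array (schur A y))).
    by rewrite (fr.1 0) // n1; case: ins.
  move=> i l s3 im lm s3i s3l fr3 keep.
  rewrite /= s3i s3l keep (fr3.2 8) // (fr3.2 4) // al.
  rewrite (h1 (Ordinal im)) // (h1 (Ordinal lm)) // div1r.
  rewrite (mx_arrayE (schur A y) (Ordinal im) (Ordinal lm)).
  rewrite (fr.2 3) // o1 // (sA (Ordinal im) (Ordinal lm)).
  rewrite [RHS]mxE; congr (_ + _); rewrite [RHS]mxE; congr (- _).
  rewrite [RHS]mxE; congr (_ * _); rewrite [RHS]mxE big_ord1.
  by congr (_ * _); rewrite [RHS]mxE.
move=> s3 fr3 _ h3; apply: wp_rset => s4 _ _ o4 E4; split.
  by move=> a b; rewrite o4 // h3 // mx_arrayE.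
by rewrite E4 /= (fr3.2 9) // (fr3.2 8) // (fr.2 9) // o1 // al.
Qed.

(** Loop invariant: the product of the pivots so far, times the Gram determinant of the remaining
    rows for the current Schur complement, is the determinant sought. Each round is an instance of
    [gram_detS]. *)
Lemma wp_det src A s : inputs s -> src \notin [:: 3; 4; 8; 9] ->
    holds src A s -> psdmx A ->
  wp M (det_cmd src) s (fun s' => rarr s' 9 0 0 = congdet A B (weights s)).
Proof.
move=> ins nsrc sA psdA; apply: wp_seq; apply: wp_mono.
  apply: (@wp_map2 _ (mx_array A)); first by case: ins.
  move=> i l s3 im lm s3i s3l fr3 keep; rewrite /= s3i s3l (fr3.2 src).
    by rewrite (sA (Ordinal im) (Ordinal lm)) (mx_arrayE A (Ordinal im) (Ordinal lm)).
  by move: nsrc; rewrite !inE !negb_or; case: eqP.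
move=> s1 fr1 _ h1; apply: wp_seq; apply: wp_rset => s2 n2 _ o2 E2.
pose y a := \row_l (mx_array B a l * weights s l).
pose I j s3 := exists A', [/\ psdmx A', holds 3 A' s3 &
  rarr s3 9 0 0 * gram_det (d - j) (fun a => y (a + j)%N) A' = congdet A B (weights s)].
apply: (@wp_mono _ _ _ _ (I d)); last first.
  by move=> s3 _ _ [A' [_ _]]; rewrite subnn gram_det0 mulr1.
apply: wp_for => //.
- by move=> s3 fr; rewrite /= fr.1 // n2 fr1.1 //; case: ins.
- exists A; split=> //; first by move=> a b; rewrite o2 // h1 // mx_arrayE.
  rewrite E2 /= mul1r subn0 congdet_gram /gram_det; congr (\det _).
  by apply/matrixP => a b; rewrite [LHS]mxE [RHS]mxE !addn0.
move=> j s3 jd s3j fr [A' [psd' h3 h9]].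
have in3 : inputs s3.
  apply: (inputs_frame ins); rewrite ?(fr.1 0) ?(fr.1 1) ?(fr.2 1) ?n2 ?o2 //.
  - by rewrite (fr1.1 0).
  - by rewrite (fr1.1 1).
  - by rewrite (fr1.2 1).
apply: (wp_mono (wp_pivot in3 s3j h3 psd')) => s4 _ _ [g1 g2].
have yE : brow s3 j = y j.
  apply/rowP => l; rewrite !mxE !ffunE (fr.2 6) // o2 // (fr1.2 6) //.
exists (schur A' (y j)); split; first exact: psd_schur.
  by rewrite -yE.
rewrite -h9 g2 yE -mulrA; congr (_ * _).
rewrite -(subnSK jd) gram_detS // add0n; congr (_ * _).
rewrite /gram_det; congr (\det _); apply/matrixP => a b; rewrite !mxE.
by rewrite !addSnnS.
Qed.

End DetCmd.

Definition cand_cmd (src : nat) : cmd :=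
  If (TRLe (RGet 6 (NReg 14) (NCst 0)) (RCst 0)) Skip
    (Seq (sset 11 (RGet 6 (NReg 14) (NCst 0)))
    (Seq (RSet 6 (NReg 14) (NCst 0) (RCst 0))
    (Seq (det_cmd src)
    (Seq (RSet 6 (NReg 14) (NCst 0) (sget 11))
         (If (TRLe (sget 9) (sget 10)) Skip
           (Seq (sset 10 (sget 9)) (NSet 15 (NReg 14)))))))).

(** The initial record [-1] lies below every determinant of a positive semidefinite form, so the
    first nonzero weight always becomes a candidate, even if its deletion gives 0. *)
Definition delete_cmd (src : nat) : cmd :=
  Seq (sset 10 (RCst (-1)))
  (Seq (For 14 (NReg 0) (cand_cmd src))
       (RSet 6 (NReg 15) (NCst 0) (RCst 0))).

Definition round_cmd (src : nat) : cmd :=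
  For 13 (NSub (NReg 0) (NReg 1)) (delete_cmd src).

(** * Correctness of the greedy rounding *)

Section RoundCmd.
Variables (R : realType) (M m d : nat) (B : 'M[R]_(d, m)).
Hypotheses (mM : (m <= M)%N) (dM : (d <= M)%N).
Variables (src : nat) (A : 'M[R]_m).
Hypotheses (src_ok : src \notin [:: 3; 4; 6; 8; 9; 10; 11]) (psdA : psdmx A).
Implicit Types (s : state R) (x : {ffun 'I_m -> R}).

Let f := congdet A B.

Let src_fresh a : a \in [:: 3; 4; 6; 8; 9; 10; 11] -> src != a.
Proof. by move=> ha; apply: contraNneq src_ok => ->. Qed.

Let wp_det' s : inputs B s -> holds src A s ->
  wp M (det_cmd src) s (fun s' => rarr s' 9 0 0 = f (weights m s)).
Proof.
move=> ins sA; apply: wp_det => //.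
by rewrite !inE !negb_or !src_fresh.
Qed.

Lemma wp_cand (i : 'I_m) s : inputs B s -> holds src A s -> nreg s 14 = i ->
    (forall j, 0 <= weights m s j) ->
  let x := weights m s in
  wp M (cand_cmd src) s (fun s' =>
    weights m s' = x /\
    (if (x i == 0) || (f (xdel x i) <= rarr s 10 0 0)
     then rarr s' 10 0 0 = rarr s 10 0 0 /\ nreg s' 15 = nreg s 15
     else rarr s' 10 0 0 = f (xdel x i) /\ nreg s' 15 = i)).
Proof.
move=> ins sA si x0 x.
have xiE : rarr s 6 i 0 = x i by rewrite ffunE.
apply: wp_if; rewrite /= si xiE => h.
  have -> : x i == 0 by rewrite eq_le h x0.
  by apply: wp_skip.
have -> : (x i == 0) = false by apply: contraNF h => /eqP ->.
apply: wp_seq; apply: wp_rset => s1 n1 _ o1 E1; rewrite /= si xiE in E1.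
apply: wp_seq; apply: wp_rset => s2 n2 _ o2 E2; rewrite /= n1 si in E2.
have w2 : weights m s2 = xdel x i.
  apply/ffunP => j; rewrite !ffunE E2 andbT val_eqE.
  by case: eqP => // _; rewrite o1 // ffunE.
have in2 : inputs B s2.
  by apply: (inputs_frame ins); rewrite ?n2 ?n1 // o2 // o1.
have A2 : holds src A s2 by move=> a b; rewrite o2 ?src_fresh // o1 ?src_fresh // sA.
apply: wp_seq; apply: (wp_mono (wp_det' in2 A2)) => s3 fr3 _ d3.
rewrite w2 in d3.
apply: wp_seq; apply: wp_rset => s4 n4 _ o4 E4.
rewrite /= (fr3.1 14) // n2 n1 si (fr3.2 11) // o2 // E1 /= in E4.
have w4 : weights m s4 = x.
  apply/ffunP => j; rewrite ffunE E4 andbT val_eqE.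
  case: eqP => [-> // | /eqP ji]; rewrite (fr3.2 6) // E2 andbT val_eqE (negPf ji).
  by rewrite o1 // ffunE.
have b4 : rarr s4 10 0 0 = rarr s 10 0 0.
  by rewrite o4 // (fr3.2 10) // o2 // o1.
have r4 r : r \in [:: 14; 15] -> nreg s4 r = nreg s r.
  by rewrite !inE => /orP[] /eqP ->; rewrite n4 fr3.1 // n2 n1.
apply: wp_if; rewrite /= b4 o4 // d3 => h'.
  by apply: wp_skip; rewrite h' w4 b4 r4.
rewrite (negPf h'); apply: wp_seq; apply: wp_rset => s5 n5 _ o5 E5.
apply: wp_nset; split.
  by rewrite -w4; apply/ffunP => j; rewrite !ffunE /= o5.
by rewrite /= /upd /= E5 /= o4 // d3 n5 r4.
Qed.

Lemma wp_delete s : inputs B s -> holds src A s ->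
    (forall j, 0 <= weights m s j) -> (0 < #|xsupp (weights m s)|)%N ->
  let x := weights m s in
  wp M (delete_cmd src) s (fun s' => exists i,
    [/\ x i != 0, forall j, x j != 0 -> f (xdel x j) <= f (xdel x i)
      & weights m s' = xdel x i]).
Proof.
move=> ins sA x0 /card_gt0P[i1 xi1] x; rewrite inE in xi1.
apply: wp_seq; apply: wp_rset => s1 n1 _ o1 E1; rewrite /= in E1.
(* Either all weights scanned so far are zero and the record is still [-1], or register 15 holds the
   best deletion among them. *)
pose I j s2 := weights m s2 = x /\
  ((rarr s2 10 0 0 = -1 /\ forall i : 'I_m, (i < j)%N -> x i = 0) \/
   exists i : 'I_m, [/\ nreg s2 15 = i, x i != 0, rarr s2 10 0 0 = f (xdel x i)
     & forall l : 'I_m, (l < j)%N -> x l != 0 -> f (xdel x l) <= f (xdel x i)]).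
have w1 : weights m s1 = x by apply/ffunP => j; rewrite !ffunE o1.
apply: wp_seq; apply: (@wp_mono _ _ _ _ (I m)).
  apply: wp_for => //.
  - by move=> s2 fr; rewrite /= fr.1 // n1; case: ins.
  - by split=> //; left; split=> //; rewrite E1.
  move=> j s2 jm s2j fr [w2 h2].
  have in2 : inputs B s2.
    by apply: (inputs_frame ins); rewrite ?(fr.1 0) ?(fr.1 1) ?(fr.2 1) ?n1 ?o1.
  have A2 : holds src A s2.
    move=> a b; rewrite fr.2 ?o1 ?src_fresh // ?sA //.
    by rewrite /= !inE !negb_or !src_fresh.
  have x2 : forall j, 0 <= weights m s2 j by rewrite w2.
  apply: (wp_mono (@wp_cand (Ordinal jm) s2 in2 A2 s2j x2)) => s3 _ _ [w3 h3].
  rewrite w2 in w3 h3; split; first by rewrite w3.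
  move: h3; set v := f _.
  have v0 : 0 <= v by apply: congdet_ge0.
  have split_lt (l : 'I_m) : (l < j.+1)%N -> l = Ordinal jm \/ (l < j)%N.
    by rewrite ltnS leq_eqVlt => /orP[/eqP e|]; [left; apply: val_inj | right].
  case: (eqVneq (x (Ordinal jm)) 0) => [xj [b3 r3] | xj] /=.
    case: h2 => [[b2 z2] | [i [r2 xi b2 z2]]].
      left; rewrite b3 b2; split=> // l /split_lt[-> // | ]; exact: z2.
    right; exists i; rewrite b3 r3; split=> // l /split_lt[-> | ]; last exact: z2.
    by rewrite xj eqxx.
  case: leP => hv [b3 r3].
    case: h2 => [[b2 z2] | [i [r2 xi b2 z2]]].
      by move: hv; rewrite b2 => hv; exfalso; move: v0 hv; lra.
    right; exists i; rewrite b3 r3; split=> // l /split_lt[-> _ | ]; last exact: z2.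
    by rewrite -b2.
  right; exists (Ordinal jm); rewrite b3 r3; split=> // l /split_lt[-> // | lj xl].
  case: h2 => [[b2 z2] | [i [r2 xi b2 z2]]]; first by rewrite z2 ?eqxx in xl.
  by apply: le_trans (ltW hv); rewrite b2 z2.
move=> s2 fr _ [w2 [[_ z] | [i [r2 xi _ z]]]]; first by rewrite z ?eqxx in xi1.
apply: wp_rset => s3 _ _ _ E3; exists i; split=> //.
  by move=> l; apply: z.
apply/ffunP => l; rewrite -w2 !ffunE E3 /= r2 andbT val_eqE.
by case: eqP.
Qed.

Lemma wp_round s : inputs B s -> holds src A s -> (forall j, 0 < weights m s j) ->
  wp M (round_cmd src) s (fun s' =>
    greedy f (m - d) (weights m s) (weights m s')).
Proof.
move=> ins sA x0; set x := weights m s.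
pose I r s2 := greedy f r x (weights m s2).
apply: (@wp_mono _ _ _ _ (I (m - d)%N)) => //.
apply: wp_for => //.
- by rewrite (leq_trans (leq_subr _ _)).
- by move=> s2 fr; rewrite /= !fr.1 //; case: ins => -> ->.
move=> r s2 rm s2r fr I2.
have in2 : inputs B s2.
  by apply: (inputs_frame ins); rewrite ?(fr.1 0) ?(fr.1 1) ?(fr.2 1).
have A2 : holds src A s2.
  move=> a b; rewrite fr.2 ?sA //.
  by rewrite /= !inE !negb_or !src_fresh.
have [cx wx] := greedy_supp I2.
(* All initial weights are positive, so after [r < m - d] deletions there is still a nonzero weight
   to delete. *)
have sx : #|xsupp x| = m.
  rewrite -[RHS]card_ord; apply: eq_card => i; rewrite !inE gt_eqF //.
have x2 j : 0 <= weights m s2 j by case: (wx j) => ->; rewrite // ltW.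
apply: wp_mono (@wp_delete s2 in2 A2 x2 _) _ => [|s3 _ _ [i [xi mx wi]]].
  by rewrite lt0n; apply/eqP => c0; rewrite c0 sx in cx; lia.
by exists (weights m s2), i.
Qed.

End RoundCmd.

Definition bit_cmd : cmd :=
  Seq (Flip 19)
    (RSet 6 (NReg 17) (NCst 0)
      (RAdd (RGet 6 (NReg 17) (NCst 0)) (RGet 6 (NReg 17) (NCst 0)))).

Definition carry_cmd : cmd :=
  If (TNLe (NCst 1) (NReg 19))
    (RSet 6 (NReg 17) (NCst 0) (RAdd (RGet 6 (NReg 17) (NCst 0)) (RCst 1))) Skip.

(** Each weight is read by Horner's rule, most significant bit first, from [m + 3] coins; the final
    increment makes it positive. *)
Definition draw_cmd : cmd :=
  For 17 (NReg 0)
    (Seq (RSet 6 (NReg 17) (NCst 0) (RCst 0))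
    (Seq (For 18 (NAdd (NReg 0) (NCst 3)) (Seq bit_cmd carry_cmd))
         (RSet 6 (NReg 17) (NCst 0) (RAdd (RGet 6 (NReg 17) (NCst 0)) (RCst 1))))).

Definition out_cmd : cmd :=
  For 20 (NReg 0) (RSet 2 (NReg 20) (NCst 0) (RGet 6 (NReg 20) (NCst 0))).

Definition trial_cmd : cmd :=
  Seq draw_cmd
  (Seq (round_cmd 0)
  (Seq (det_cmd 0)
       (If (TRLe (sget 9) (sget 12)) Skip (Seq (sset 12 (sget 9)) out_cmd)))).

(** The factor [k] is a constant of the program, so the product unfolds into a sum, the only
    operation available on registers. *)
Fixpoint nmul (k : nat) (e : nexp) : nexp :=
  if k is k'.+1 then NAdd e (nmul k' e) else NCst 0.

(* The rounding of the all-ones weights for the identity form yields a basis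
   even if every trial fails. *)
Definition main_cmd (k : nat) : cmd :=
  Seq (For 21 (NReg 0) (RSet 7 (NReg 21) (NReg 21) (RCst 1)))
  (Seq (For 21 (NReg 0) (RSet 6 (NReg 21) (NCst 0) (RCst 1)))
  (Seq (round_cmd 7)
  (Seq out_cmd
       (For 16 (nmul k (NReg 0)) trial_cmd)))).

Definition bits_val (w : seq bool) : nat := foldl (fun (a : nat) (b : bool) => a.*2 + b)%N 0%N w.

Section DrawCmd.
Variables (R : realType) (M m : nat).
Hypotheses (mM : (m + 3 <= M)%N).
Implicit Types (s : state R) (w : seq bool).

Let q := (m + 3)%N.

Definition drawn w : {ffun 'I_m -> R} :=
  [ffun i : 'I_m => (bits_val (take q (drop (i * q) w))).+1%:R].

Definition out s : {ffun 'I_m -> R} := [ffun i : 'I_m => rarr s 2 i 0%N].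

Lemma wp_bit i n w s : nreg s 17 = i -> coins s = drop n w -> (n < size w)%N ->
  wp M (Seq bit_cmd carry_cmd) s (fun s' =>
    [/\ coins s' = drop n.+1 w,
        forall i', i' != i -> rarr s' 6 i' 0 = rarr s 6 i' 0
      & rarr s' 6 i 0 = rarr s 6 i 0 *+ 2 + (nth false w n)%:R]).
Proof.
move=> si sw nw; rewrite (drop_nth false nw) in sw.
apply: wp_seq; apply: wp_seq; apply: wp_flip; apply: wp_rset => s1 n1 c1 _ E1.
rewrite /= /upd /= si in E1.
have r1 : nreg s1 17 = i by rewrite n1 /= /upd /= si.
have b1 : nreg s1 19 = nth false w n by rewrite n1 /= /upd /= sw.
have {}c1 : coins s1 = drop n.+1 w by rewrite c1 /= sw.
apply: wp_if; rewrite /= b1 => h.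
  apply: wp_rset => s2 _ c2 _ E2; rewrite /= r1 in E2; split.
  - by rewrite c2.
  - by move=> i' ni; rewrite E2 (negPf ni) /= E1 (negPf ni).
  - by rewrite E2 eqxx /= E1 eqxx /= -mulr2n; case: nth h.
apply: wp_skip; split=> //.
  by move=> i' ni; rewrite E1 (negPf ni).
by rewrite E1 eqxx /= -mulr2n; case: nth h => //; rewrite addr0.
Qed.

Lemma wp_draw w s : nreg s 0 = m -> coins s = w -> (m * q <= size w)%N ->
  wp M draw_cmd s (fun s' => weights m s' = drawn w /\ coins s' = drop (m * q) w).
Proof.
move=> sm sw wq.
pose I i s1 := coins s1 = drop (i * q) w /\
  forall i0 : 'I_m, (i0 < i)%N -> rarr s1 6 i0 0 = drawn w i0.
apply: (@wp_mono _ _ _ _ (I m)); last first.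
  move=> s1 _ _ [c1 h1]; split=> //; apply/ffunP => i.
  by rewrite [LHS]ffunE h1.
apply: wp_for => //.
- by apply: leq_trans mM; apply: leq_addr.
- by move=> s1 fr; rewrite /= fr.1.
- by split=> //; rewrite mul0n drop0.
move=> i s1 im s1i fr [c1 h1].
apply: wp_seq; apply: wp_rset => s2 n2 c2 _ E2; rewrite /= s1i in E2.
pose J b s3 := [/\ coins s3 = drop (i * q + b) w,
  forall i', i' != i -> rarr s3 6 i' 0 = rarr s1 6 i' 0 &
  rarr s3 6 i 0 = (bits_val (take b (drop (i * q) w)))%:R].
have iq : (i * q + q <= size w)%N.
  by apply: leq_trans wq; rewrite addnC -mulSn leq_mul2r im orbT.
apply: wp_seq; apply: (@wp_mono _ _ _ _ (J q)).
  apply: wp_for => //.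
  - by move=> s3 fr3; rewrite /= fr3.1 // n2 fr.1 // sm.
  - split; first by rewrite addn0 c2.
      by move=> i' ni; rewrite E2 (negPf ni).
    by rewrite E2 eqxx /= take0.
  move=> b s3 bq s3b fr3 [c3 g3 v3].
  have lt : (i * q + b < size w)%N by apply: leq_trans iq; rewrite ltn_add2l.
  have r3 : nreg s3 17 = i by rewrite fr3.1 // n2.
  apply: (wp_mono (wp_bit r3 c3 lt)) => s4 _ _ [c4 g4 v4]; split.
  - by rewrite addnS.
  - by move=> i' ni; rewrite g4 // g3.
  rewrite v4 v3 (take_nth false); last by rewrite size_drop ltn_subRL.
  rewrite nth_drop /bits_val foldl_rcons -/(bits_val _).
  by rewrite natrD -addnn natrD mulr2n.
move=> s3 fr3 _ [c3 g3 v3]; apply: wp_rset => s4 _ c4 _ E4.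
rewrite /= (fr3.1 17) // n2 s1i in E4; split.
  by rewrite c4 c3 mulSn addnC.
move=> i0; rewrite ltnS leq_eqVlt => /orP[/eqP e | lt].
  by rewrite e E4 eqxx /= v3 ffunE e natr1.
by rewrite E4 ltn_eqF //= g3 ?ltn_eqF // h1.
Qed.

Lemma wp_out s : nreg s 0 = m -> wp M out_cmd s (fun s' => out s' = weights m s).
Proof.
move=> sm; pose I i s1 := forall i0 : 'I_m, (i0 < i)%N -> rarr s1 2 i0 0 = rarr s 6 i0 0.
apply: (@wp_mono _ _ _ _ (I m)); last first.
  by move=> s1 _ _ h; apply/ffunP => i; rewrite !ffunE h.
apply: wp_for => //.
- by apply: leq_trans mM; apply: leq_addr.
- by move=> s1 fr; rewrite /= fr.1.
move=> i s1 im s1i fr h; apply: wp_rset => s2 _ _ _ E2 i0.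
rewrite /= s1i (fr.2 6) // in E2.
rewrite ltnS leq_eqVlt E2 andbT => /orP[/eqP e | lt]; first by rewrite e eqxx.
by rewrite ltn_eqF // h.
Qed.

End DrawCmd.

(** * The loop over the trials *)

Section MainCmd.
Variables (R : realType) (M m d k : nat) (L : 'M[R]_m) (B : 'M[R]_(d, m)).
Hypotheses (m3M : (m + 3 <= M)%N) (dM : (d <= M)%N) (kM : (k * m <= M)%N).
Hypothesis psdL : psdmx L.
Variables (w : seq bool) (G : {ffun 'I_m -> R} -> Prop) (c : R).
Implicit Types s : state R.

Let q := (m + 3)%N.
Let mM : (m <= M)%N := leq_trans (leq_addr _ _) m3M.

Hypothesis w_size : (k * m * (m * q) <= size w)%N.

Let draw r := drawn R m (drop (r * (m * q)) w).

Hypothesis G_default : forall x,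
  greedy (congdet 1%:M B) (m - d) [ffun=> 1] x -> G x.
Hypothesis G_trial : forall r x, (r < k * m)%N ->
  greedy (congdet L B) (m - d) (draw r) x -> congdet L B x != 0 -> G x.
Hypothesis c_trial : forall r x, (r < k * m)%N ->
  greedy (congdet L B) (m - d) (draw r) x ->
  congdet L B (draw r) <= congdet L B x * c.
Hypothesis c_ge0 : 0 <= c.

(** The record in array 12 is 0 while the output is the default basis. Improvements are strict, so
    any trial that reaches the output has a nonzero determinant, as [G_trial] demands. The last
    clause bounds the value at every earlier draw by the record. *)
Definition main_inv r s : Prop :=
  [/\ coins s = drop (r * (m * q)) w, G (out m s),
      (rarr s 12 0 0 = 0 \/ rarr s 12 0 0 = congdet L B (out m s) /\
         exists2 r', (r' < k * m)%N &
           greedy (congdet L B) (m - d) (draw r') (out m s)),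
      0 <= rarr s 12 0 0
    & forall r', (r' < r)%N -> congdet L B (draw r') <= rarr s 12 0 0 * c].

Lemma wp_trial r s : (r < k * m)%N -> inputs B s -> holds 0 L s ->
  main_inv r s -> wp M trial_cmd s (main_inv r.+1).
Proof.
move=> rk ins sL [cs Gs bs b0 bc].
have sm : nreg s 0 = m by case: ins.
have szw : (m * q <= size (drop (r * (m * q)) w))%N.
  rewrite size_drop leq_subRL.
    by rewrite addnC -mulSn; apply: leq_trans w_size; rewrite leq_mul2r rk orbT.
  by apply: leq_trans w_size; rewrite leq_mul2r ltnW ?orbT.
apply: wp_seq; apply: (wp_mono (wp_draw m3M sm cs szw)) => s1 fr1 _ [w1 c1].
rewrite drop_drop -mulSn in c1; rewrite -/(draw r) in w1.
have in1 : inputs B s1 by apply: (inputs_frame ins); rewrite ?(fr1.1 0) ?(fr1.1 1) ?(fr1.2 1).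
have L1 : holds 0 L s1 by move=> a b; rewrite (fr1.2 0).
have pos1 j : 0 < weights m s1 j by rewrite w1 ffunE ltr0n.
apply: wp_seq.
apply: (wp_mono (@wp_round R M m d B mM dM 0%N L isT psdL s1 in1 L1 pos1)) => s2 fr2 c2 g2.
have {}c2 := c2 isT; rewrite w1 in g2.
have in2 : inputs B s2 by apply: (inputs_frame in1); rewrite ?(fr2.1 0) ?(fr2.1 1) ?(fr2.2 1).
have L2 : holds 0 L s2 by move=> a b; rewrite (fr2.2 0).
apply: wp_seq.
apply: (wp_mono (@wp_det R M m d B mM dM 0%N L s2 in2 isT L2 psdL)) => s3 fr3 c3 d3.
have {}c3 := c3 isT.
have cs3 : coins s3 = drop (r.+1 * (m * q)) w by rewrite c3 c2 c1.
have b3 : rarr s3 12 0 0 = rarr s 12 0 0 by rewrite (fr3.2 12) // (fr2.2 12) // (fr1.2 12).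
have o3 : out m s3 = out m s.
  by apply/ffunP => i; rewrite !ffunE (fr3.2 2) // (fr2.2 2) // (fr1.2 2).
have w3 : weights m s3 = weights m s2.
  by apply/ffunP => i; rewrite !ffunE (fr3.2 6).
have cx := c_trial rk g2; set y := weights m s2 in d3 g2 cx w3 *.
apply: wp_if; rewrite /= b3 d3 => h.
  apply: wp_skip; split; rewrite ?b3 ?o3 // => r'.
  rewrite ltnS leq_eqVlt => /orP[/eqP -> | /bc //].
  by apply: le_trans cx _; apply: ler_wpM2r.
rewrite -ltNge in h.
apply: wp_seq; apply: wp_rset => s4 n4 c4 o4 E4; rewrite /= d3 in E4.
have m4 : nreg s4 0 = m by rewrite n4 (fr3.1 0) // (fr2.1 0) // (fr1.1 0).
apply: (wp_mono (wp_out m3M m4)) => s5 fr5 c5 o5.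
have w4 : weights m s4 = y by rewrite -w3; apply/ffunP => i; rewrite !ffunE o4.
rewrite w4 in o5; have y0 : 0 < congdet L B y by apply: le_lt_trans h.
have b5 : rarr s5 12 0 0 = congdet L B y by rewrite (fr5.2 12) // E4.
split; rewrite ?o5 ?b5.
- by rewrite (c5 isT) c4.
- by apply: (G_trial rk g2); rewrite gt_eqF.
- by right; split=> //; exists r.
- exact: ltW.
move=> r'; rewrite ltnS leq_eqVlt => /orP[/eqP -> // | /bc hr].
by apply: le_trans hr _; apply: ler_wpM2r => //; exact: ltW.
Qed.

Lemma neval_nmul s n e : neval s (nmul n e) = (n * neval s e)%N.
Proof. by elim: n => //= n ->; rewrite mulSn. Qed.

Lemma wp_main : wp M (main_cmd k) (init L B w) (main_inv (k * m)).
Proof.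
set s0 := init L B w.
have in0 : inputs B s0 by [].
apply: wp_seq.
pose I i s1 := forall a b : 'I_m,
  rarr s1 7 a b = if (a < i)%N then (a == b)%:R else 0 :> R.
apply: (@wp_mono _ _ _ _ (I m)).
  apply: wp_for => //; first by move=> s1 fr; rewrite /= fr.1.
  move=> i s1 im s1i fr h; apply: wp_rset => s2 _ _ _ E2 a b.
  rewrite /= s1i in E2; rewrite E2 h ltnS [(a <= i)%N]leq_eqVlt.
  case: (eqVneq (a : nat) i) => [e | ne] //=.
  by rewrite e ltnn -val_eqE /= e eq_sym; case: eqP.
move=> s1 fr1 c1 h1; have {}c1 := c1 isT.
have id1 : holds 7 (1%:M : 'M[R]_m) s1.
  by move=> a b; rewrite h1 ltn_ord mxE.
apply: wp_seq.
pose J i s2 := forall a : 'I_m, (a < i)%N -> rarr s2 6 a 0 = 1 :> R.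
apply: (@wp_mono _ _ _ _ (J m)).
  apply: wp_for => //; first by move=> s2 fr; rewrite /= fr.1 // fr1.1.
  move=> i s2 im s2i fr h; apply: wp_rset => s3 _ _ _ E3 a.
  rewrite /= s2i in E3; rewrite ltnS leq_eqVlt E3 andbT; case: eqP => //= _; exact: h.
move=> s2 fr2 c2 h2; have {}c2 := c2 isT.
have w2 : weights m s2 = [ffun=> 1] by apply/ffunP => i; rewrite !ffunE h2.
have in2 : inputs B s2.
  apply: (inputs_frame in0).
  - by rewrite (fr2.1 0) // (fr1.1 0).
  - by rewrite (fr2.1 1) // (fr1.1 1).
  - by rewrite (fr2.2 1) // (fr1.2 1).
have id2 : holds 7 (1%:M : 'M[R]_m) s2 by move=> a b; rewrite (fr2.2 7).
have pos2 j : 0 < weights m s2 j by rewrite w2 ffunE.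
apply: wp_seq.
apply: (wp_mono (@wp_round R M m d B mM dM 7%N 1%:M isT (psdmx1 R m) s2 in2 id2 pos2)).
move=> s3 fr3 c3 g3; have {}c3 := c3 isT; rewrite w2 in g3.
have m3 : nreg s3 0 = m by rewrite (fr3.1 0) //; case: in2.
apply: wp_seq; apply: (wp_mono (wp_out m3M m3)) => s4 fr4 c4 o4; have {}c4 := c4 isT.
have b4 : rarr s4 12 0 0 = 0.
  by rewrite (fr4.2 12) // (fr3.2 12) // (fr2.2 12) // (fr1.2 12).
have in4 : inputs B s4.
  apply: (inputs_frame in2).
  - by rewrite (fr4.1 0) // (fr3.1 0).
  - by rewrite (fr4.1 1) // (fr3.1 1).
  - by rewrite (fr4.2 1) // (fr3.2 1).
have L4 : holds 0 L s4.
  move=> a b; rewrite (fr4.2 0) // (fr3.2 0) // (fr2.2 0) // (fr1.2 0) //.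
  exact: mx_arrayE.
apply: wp_for => //.
- by move=> s5 fr5; rewrite neval_nmul /= fr5.1 //; case: in4 => ->.
- split; rewrite ?b4 //; first by rewrite c4 c3 c2 c1 mul0n drop0.
    by rewrite o4; apply: G_default.
  by left.
move=> r s5 rk s5r fr5 inv5; apply: wp_trial => //.
  by apply: (inputs_frame in4); rewrite ?(fr5.1 0) ?(fr5.1 1) ?(fr5.2 1).
by move=> a b; rewrite (fr5.2 0).
Qed.

End MainCmd.

(** * Coin tapes *)

(** Independence of the first [a] coins from the last [b], in counting form. *)
Lemma card_cat_tuple (a b : nat) (P1 P2 : pred (seq bool)) :
  #|[set w : (a + b).-tuple bool | P1 (take a w) && P2 (drop a w)]| =
  (#|[set u : a.-tuple bool | P1 u]| * #|[set v : b.-tuple bool | P2 v]|)%N.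
Proof.
pose f (p : a.-tuple bool * b.-tuple bool) : (a + b).-tuple bool :=
  cat_tuple p.1 p.2.
have injf : injective f.
  move=> [u v] [u' v'] /(congr1 val) /eqP /=.
  by rewrite eqseq_cat ?size_tuple // => /andP[/eqP /val_inj -> /eqP /val_inj ->].
have bijf : bijective f.
  by apply: inj_card_bij => //; rewrite card_prod !card_tuple expnD.
rewrite -(on_card_preimset (f := f)); last by apply: onW_bij.
rewrite -cardsX; apply: eq_card => -[u v].
by rewrite !inE /= take_size_cat ?drop_size_cat ?size_tuple.
Qed.

(** Disjoint blocks of [Q] coins are independent, and [Pb] sees only one block, so [n] events of
    probability at most 1/2 occur together with probability at most [2 ^ (- n)]; the rest of the
    tape is free. *)
Lemma card_all_blocks (Pb : pred (seq bool)) (Q n T : nat) :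
    (forall w, Pb w = Pb (take Q w)) -> (n * Q <= T)%N ->
    (2 * #|[set u : Q.-tuple bool | Pb u]| <= 2 ^ Q)%N ->
  (2 ^ n * #|[set w : T.-tuple bool |
     all (fun r => Pb (drop (r * Q) w)) (iota 0 n)]| <= 2 ^ T)%N.
Proof.
move=> PbQ nT half; elim: n T nT => [|n IH] T nT.
  rewrite mul1n (leq_trans (max_card _)) // card_tuple card_bool //.
have QT : (Q <= T)%N by apply: leq_trans nT; rewrite mulSn leq_addr.
move: nT; rewrite -(subnKC QT) mulSn leq_add2l => /IH {IH}.
set T' := (T - Q)%N => IH.
pose P2 v := all (fun r => Pb (drop (r * Q) v)) (iota 0 n).
have -> : #|[set w : (Q + T').-tuple bool |
    all (fun r => Pb (drop (r * Q) w)) (iota 0 n.+1)]| =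
    #|[set w : (Q + T').-tuple bool | Pb (take Q w) && P2 (drop Q w)]|.
  apply: eq_card => w; rewrite !inE /= mul0n drop0 -PbQ; congr (_ && _).
  rewrite (iotaDl 1 0) all_map; apply: eq_all => r /=.
  by rewrite drop_drop add1n mulSn addnC.
rewrite (card_cat_tuple _ _ Pb P2) expnS expnD mulnACA.
exact: leq_mul.
Qed.

Lemma bits_val_lt (w : seq bool) : (bits_val w < 2 ^ size w)%N.
Proof.
elim/last_ind: w => // w b IH.
rewrite /bits_val foldl_rcons -/(bits_val w) size_rcons expnS mul2n.
by case: b; rewrite -!addnn; lia.
Qed.

Lemma bits_val_inj (u v : seq bool) : size u = size v ->
  bits_val u = bits_val v -> u = v.
Proof.
elim/last_ind: u v => [|u a IH] v; first by case: v.
case/lastP: v => [|v b]; first by rewrite size_rcons.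
rewrite !size_rcons => -[suv].
rewrite /bits_val !foldl_rcons -/(bits_val u) -/(bits_val v) => E.
have ab : a = b.
  by have := congr1 odd E; rewrite !oddD !odd_double; case: (a); case: (b).
by rewrite (IH v suv) ?ab //; move: E; rewrite ab => /addIn /double_inj.
Qed.

Lemma blocks_inj (q n : nat) (u v : seq bool) :
    size u = (n * q)%N -> size v = (n * q)%N ->
    (forall i, (i < n)%N -> take q (drop (i * q) u) = take q (drop (i * q) v)) ->
  u = v.
Proof.
elim: n u v => [|n IH] u v.
  by rewrite mul0n => /size0nil -> /size0nil ->.
rewrite mulSn => su sv h.
rewrite -(cat_take_drop q u) -(cat_take_drop q v); congr (_ ++ _).
  by have := h 0%N isT; rewrite mul0n !drop0.
apply: IH; rewrite ?size_drop ?su ?sv ?addKn // => i lt.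
by rewrite !drop_drop addnC -mulSn h.
Qed.

Section GridOfBits.
Variables (R : realType) (m : nat).
Local Notation q := (m + 3)%N.

Lemma block_lt (w : seq bool) : (bits_val (take q w) < 2 ^ q)%N.
Proof.
by apply: leq_trans (bits_val_lt _) _; rewrite leq_exp2l // size_take_min geq_minl.
Qed.

Definition grid_of (w : seq bool) : {ffun 'I_m -> 'I_(2 ^ q)} :=
  [ffun i : 'I_m => Ordinal (block_lt (drop (i * q) w))].

Lemma gridval_of w : gridval R (grid_of w) = drawn R m w.
Proof. by apply/ffunP => i; rewrite !ffunE. Qed.

Lemma grid_of_take w : grid_of (take (m * q) w) = grid_of w.
Proof.
apply/ffunP => i; rewrite !ffunE; apply: val_inj => /=; congr bits_val.
have le : (q <= m * q - i * q)%N.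
  by rewrite -mulnBl leq_pmull // subn_gt0.
have -> : drop (i * q) (take (m * q) w) = take (m * q - i * q) (drop (i * q) w).
  by rewrite take_drop subnK // leq_mul2r ltnW ?orbT.
by rewrite take_takel.
Qed.

Lemma grid_of_inj : injective (fun u : (m * q).-tuple bool => grid_of u).
Proof.
move=> u v E; apply: val_inj.
apply: (@blocks_inj q m); rewrite ?size_tuple // => i im.
have sz (z : (m * q).-tuple bool) : size (take q (drop (i * q) z)) = q.
  rewrite size_takel // size_drop size_tuple -mulnBl leq_pmull // subn_gt0 //.
apply: bits_val_inj; first by rewrite !sz.
by have /ffunP/(_ (Ordinal im)) := E; rewrite !ffunE => -[].
Qed.

(** There are as many tapes as grid points, and bad tapes inject into bad points by
    [grid_of_inj]. *)
Lemma card_bad_tape (bad : pred {ffun 'I_m -> 'I_(2 ^ q)}) :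
  (2 * #|[set x | bad x]| <= (2 ^ q) ^ m)%N ->
  (2 * #|[set u : (m * q).-tuple bool | bad (grid_of u)]| <= 2 ^ (m * q))%N.
Proof.
move=> h; rewrite [X in (_ <= 2 ^ X)%N]mulnC expnM; apply: leq_trans h; rewrite leq_mul2l /=.
rewrite -(card_imset _ grid_of_inj); apply/subset_leq_card/subsetP => x.
by case/imsetP => u; rewrite !inE => hu ->.
Qed.

End GridOfBits.

Lemma bin_le_exp2 n k : ('C(n, k) <= 2 ^ n)%N.
Proof.
elim: n k => [|n IH] [|k]; rewrite ?bin0 ?bin0n ?expn_gt0 //.
by rewrite binS expnS mul2n -addnn leq_add.
Qed.

Lemma bin_le_expn n k : ('C(n, k) <= n ^ k)%N.
Proof.
elim: n k => [|n IH] [|k]; rewrite ?bin0 ?bin0n //.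
rewrite binS; apply: leq_trans (leq_add (IH _) (IH _)) _.
by rewrite expnS -mulSnr expnS leq_mul2l /=; case: k => // k; rewrite leq_exp2r.
Qed.

(** The cost arises from the loop bound and constants by sums and products. With [K = k.+1], the
    bound [K * m + 3] covers all loop lengths of the program: [m], [d], [m - d], [m + 3] and
    [k * m]. *)
Lemma cost_poly (K : nat) (c : cmd) :
  exists p : {poly nat}, forall m, cost (K * m + 3) c = p.[m].
Proof.
have one : exists p : {poly nat}, forall m : nat, 1%N = p.[m].
  by exists 1%:P => m; rewrite hornerC.
elim: c => //=.
- move=> c1 [p1 h1] c2 [p2 h2]; exists (p1 + p2 + 1%:P) => m.
  by rewrite !hornerD hornerC -h1 -h2 -addn1.
- move=> _ c1 [p1 h1] c2 [p2 h2]; exists (p1 + p2 + 1%:P) => m.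
  by rewrite !hornerD hornerC -h1 -h2 -addn1.
move=> _ c1 [p1 h1]; exists ((K%:P * 'X + 3%:P) * (p1 + 1%:P) + 1%:P) => m.
rewrite !(hornerD, hornerM, hornerC, hornerX) -h1.
by rewrite -[LHS]addn1 -[(cost _ _).+1]addn1.
Qed.

(** * The approximation guarantee *)

Lemma ln2_ge_half (R : realType) : 1 / 2 <= ln (2 : R).
Proof.
have := @le_ln1Dx R (- (1 / 2)).
rewrite (_ : 1 + - (1 / 2) = 2^-1) ?lnV ?posrE //; last by lra.
by move=> /(_ _) h; have : - ln 2 <= - (1 / 2) :> R; [apply: h; lra | lra].
Qed.

(** Here [256 ^ d * 'C(m, d) <= 2 ^ (8 m) * 2 ^ m], with square at most [2 ^ (18 m)]; the constant
    36 comes from [factor_log]. *)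
Lemma factor_linear (R : realType) (m d : nat) : (d <= m)%N ->
  2 `^ (- (36 * m%:R)) * (256 ^ d * 'C(m, d))%:R ^+ 2 <= 1 :> R.
Proof.
move=> dm; rewrite powRN -natrM powR_mulrn // mulrC ler_pdivrMr ?exprn_gt0 // mul1r.
rewrite -!natrX ler_nat (_ : 36 * m = 18 * m * 2)%N; last by lia.
rewrite expnM leq_exp2r //; apply: leq_trans (_ : 2 ^ (8 * m + m) <= _)%N.
  rewrite expnD leq_mul ?bin_le_exp2 // (_ : 256 = 2 ^ 8)%N // -expnM leq_exp2l //.
  by rewrite leq_mul2l.
by rewrite leq_exp2l //; lia.
Qed.

Lemma factor_log (R : realType) (m d : nat) : (1 < m)%N ->
  2 `^ (- (36 * (d%:R * ln m%:R))) * (256 ^ d * 'C(m, d))%:R ^+ 2 <= 1 :> R.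
Proof.
move=> m1; have l2 := ln2_ge_half R; set l := ln m%:R.
have lm : ln 2 <= l by rewrite ler_ln ?posrE ?ltr0n ?ler_nat // ltnW.
rewrite powRN mulrC ler_pdivrMr ?powR_gt0 // mul1r.
(* [2 ^ 8 <= 2 ^ (16 l)] since [l >= ln 2 >= 1/2], and [m = e ^ l <= 2 ^ (2 l)] again since
   [ln 2 >= 1/2]. Raising to the power [2 d] turns 18 into 36. *)
have unit_le : (256 * m)%:R <= 2 `^ (18 * l) :> R.
  rewrite (_ : 18 * l = 16 * l + 2 * l); last by lra.
  rewrite powRD ?pnatr_eq0 ?implybT // natrM ler_pM //.
    apply: le_trans (_ : 2 `^ 8 <= _); last by apply: ler_powR; lra.
    by rewrite powR_mulrn // -natrX ler_nat.
  rewrite /powR pnatr_eq0 /= -[leLHS]lnK ?posrE ?ltr0n ?(ltnW m1) // ler_expR -/l.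
  nra.
have -> : 36 * (d%:R * l) = 18 * l * (2 * d)%:R by rewrite natrM; lra.
rewrite powRrM powR_mulrn ?powR_ge0 //.
apply: le_trans (_ : (256 * m)%:R ^+ (2 * d) <= _); last by apply: lerXn2r; rewrite ?nnegrE ?powR_ge0.
rewrite -!natrX ler_nat (mulnC 2%N d) expnM leq_exp2r // expnMn leq_mul2l.
by rewrite bin_le_expn orbT.
Qed.

Section Guarantee.
Variables (R : realType) (m : nat) (L : 'M[R]_m).
Local Notation d := (\rank L).
Variables (B C : 'M[R]_(d, m)) (H : 'M[R]_d) (M : matroid 'I_m).
Hypotheses (LE : L = C^T *m H *m C) (psdH : psdmx H).
Hypotheses (rankM : matroid_rank M = d) (tuB : totally_unimodular B).
Hypothesis repB : represents B M.
Implicit Types (x : {ffun 'I_m -> R}) (S : {set 'I_m}).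

Let dm : (d <= m)%N := rank_leq_row L.
Let c := paircoef B C.

Lemma congdet_mpeval x : congdet L B x = \det H * mpeval c x ^+ 2.
Proof. by rewrite (congdet_fact _ _ LE) pairdetE. Qed.

Lemma detH_ge0 : 0 <= \det H. Proof. exact: det_psd_ge0. Qed.

Lemma det_basis S : S \in bases M ->
  \det (principal_submx L S) = \det H * c S ^+ 2.
Proof.
move=> bS; have cS : #|S| = d by rewrite (basis_card bS).
rewrite {1}LE (det_principal_fact _ _ cS) /c -[in RHS](setenum_im cS).
rewrite paircoef_supp; last exact: setenum_inj.
by rewrite exprMn (tu_basis_det repB rankM) // mul1r.
Qed.

(** On weights supported on a basis a single monomial remains, and total unimodularity makes its
    coefficient a minor of [C] up to sign. *)
Lemma congdet_supp x : xsupp x \in bases M ->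
  congdet L B x = \prod_(i in xsupp x) x i ^+ 2 * \det (principal_submx L (xsupp x)).
Proof.
move=> bS; have cS : #|xsupp x| = d by rewrite (basis_card bS).
rewrite det_basis // (congdet_fact _ _ LE).
rewrite (pairdet_supp B C (@setenum_inj _ _ _ cS)) => [|k]; last first.
  by rewrite setenum_im inE negbK => /eqP.
rewrite -paircoef_supp; last exact: setenum_inj.
rewrite setenum_im exprMn -/c mulrCA; congr (_ * _).
rewrite prodrXl -[in RHS](setenum_im cS) big_imset /=; last first.
  by move=> i j _ _; apply: setenum_inj.
by congr (_ ^+ 2); apply: eq_bigl => i; rewrite inE.
Qed.

(** A nonzero pairing with any [C'] exhibits a nonzero minor of [B]; [C'] is [C] in the trials and
    [B] for the default basis. *)
Lemma basis_of_det x : #|xsupp x| = d ->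
  (exists C', pairdet B C' x != 0) -> xsupp x \in bases M.
Proof.
move=> cS [C']; rewrite (pairdet_supp B C' (@setenum_inj _ _ _ cS)) => [|k]; last first.
  by rewrite setenum_im inE negbK => /eqP.
rewrite !mulf_eq0 !negb_or => /andP[_ /andP[h _]].
by rewrite (basis_det repB rankM cS).
Qed.

Lemma greedy_card f x0 x : (forall i, x0 i != 0) ->
  greedy f (m - d) x0 x -> #|xsupp x0| = m /\ #|xsupp x| = d.
Proof.
move=> x0n /greedy_supp[E _].
have s0 : #|xsupp x0| = m.
  by rewrite -[RHS]card_ord; apply: eq_card => i; rewrite !inE x0n.
by split=> //; apply/eqP; rewrite -(eqn_add2r (m - d)) -E s0 subnKC.
Qed.

(** For the identity form the coefficients are squares of minors of [B], and the one at a basis is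
    1. So the value at the all-ones weights is positive, and [greedy_neq0] carries this to the
    end. *)
Lemma default_basis x :
  greedy (congdet 1%:M B) (m - d) [ffun=> 1] x -> xsupp x \in bases M.
Proof.
move=> g; have [|s0 sx] := greedy_card _ g; first by move=> i; rewrite ffunE oner_eq0.
rewrite -xsupp_sqr; apply: basis_of_det; first by rewrite xsupp_sqr.
exists B; rewrite -congdet1.
have [S0 indS0 E] : {S0 : {set 'I_m} | S0 \in indep M & matroid_rank M = #|S0|}.
  apply: eq_bigmax_cond; apply/card_gt0P; exists set0; exact: indep0.
have bS0 : S0 \in bases M by apply: indep_rank_basis.
apply: (greedy_neq0 (@paircoef_homog _ _ _ B B) _ _ g).
- by move=> y; apply: congdet_ge0; apply: psdmx1.
- by move=> y; rewrite congdet1 pairdetE.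
- by rewrite s0 subnKC.
have coef_ge0 S : 0 <= paircoef B B S.
  case: (eqVneq #|S| d) => [cS | /paircoef_homog -> //].
  by rewrite -(setenum_im cS) paircoef_supp ?sqr_ge0 -?expr2 ?sqr_ge0 //; apply: setenum_inj.
rewrite congdet1 pairdetE gt_eqF // /mpeval.
rewrite (bigD1 S0) //= ltr_pwDl //.
  have cS : #|S0| = d by rewrite (basis_card bS0).
  rewrite big1 => [|i _]; last by rewrite !ffunE expr1n.
  rewrite mulr1 -(setenum_im cS) paircoef_supp; last exact: setenum_inj.
  by rewrite -expr2 (tu_basis_det repB rankM).
apply: sumr_ge0 => S _; rewrite mulr_ge0 //; apply: prodr_ge0 => i _.
by rewrite !ffunE expr1n.
Qed.

Lemma trial_basis x0 x : (forall i, x0 i != 0) ->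
  greedy (congdet L B) (m - d) x0 x -> congdet L B x != 0 -> xsupp x \in bases M.
Proof.
move=> x0n g; have [_ sx] := greedy_card x0n g.
rewrite (congdet_fact _ _ LE) mulf_eq0 negb_or sqrf_eq0 => /andP[_ h].
by apply: basis_of_det => //; exists C.
Qed.

Lemma trial_ratio x0 x : (forall i, x0 i != 0) ->
  greedy (congdet L B) (m - d) x0 x ->
  congdet L B x0 <= congdet L B x * 'C(m, d)%:R ^+ 2.
Proof.
move=> x0n g; have [s0 _] := greedy_card x0n g.
have := greedy_sqr (@paircoef_homog _ _ _ B C) detH_ge0 congdet_mpeval g.
rewrite s0 subKn // binn expr1n mulr1; apply.
by rewrite subnKC.
Qed.

Lemma OPT_attained : exists2 S, S \in bases M & OPT L M = \det (principal_submx L S).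
Proof.
have [S0 indS0 E] : {S0 : {set 'I_m} | S0 \in indep M & matroid_rank M = #|S0|}.
  apply: eq_bigmax_cond; apply/card_gt0P; exists set0; exact: indep0.
have bS0 : S0 \in bases M by apply: indep_rank_basis.
rewrite /OPT; have [|S bS ->] := @eq_bigmax _ R _ 0 S0 [in bases M]
  (fun S => \det (principal_submx L S)) bS0; last by exists S.
by move=> S bS; rewrite det_basis // mulr_ge0 ?sqr_ge0 // detH_ge0.
Qed.

End Guarantee.

(** A halted configuration is fixed by [step], so running longer than necessary changes nothing. *)
Lemma run_wp (R : realType) (M T m d : nat) (P : cmd) (L : 'M[R]_m)
    (B : 'M[R]_(d, m)) (w : seq bool) (Q : state R -> Prop) :
  wp M P (init L B w) Q -> (cost M P <= T)%N ->
  exists2 s, run P T L B w = ([::], s) & Q s.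
Proof.
case=> s [t tM E] qs MT; exists s => //.
have fix_halt n : iter n (@step R) ([::], s) = ([::], s) by elim: n => //= n ->.
by rewrite /run -(subnK (leq_trans tM MT)) iterD E fix_halt.
Qed.

(** * Analysis of the repeated trials *)

Section Trials.
Variables (R : realType) (m k T : nat) (L : 'M[R]_m).
Local Notation d := (\rank L).
Variables (B C : 'M[R]_(d, m)) (H : 'M[R]_d) (M : matroid 'I_m).
Hypotheses (psdL : psdmx L) (LE : L = C^T *m H *m C) (psdH : psdmx H).
Hypotheses (rankM : matroid_rank M = d) (tuB : totally_unimodular B).
Hypothesis repB : represents B M.
Hypothesis T_cost : (cost (k.+1 * m + 3) (main_cmd k) <= T)%N.
Hypothesis T_coins : (k * m * (m * (m + 3)) <= T)%N.

Let dm : (d <= m)%N := rank_leq_row L.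
Let N := (2 ^ (m + 3))%N.
Local Notation S_ w := (output m (run (main_cmd k) T L B w)).

Definition bad_draw (S : {set 'I_m}) (w : seq bool) : bool :=
  `|mpeval (paircoef B C) (drawn R m w)| <
  `|paircoef B C S| * (N%:R / 256) ^+ d.

Lemma drawn_neq0 w i : drawn R m w i != 0.
Proof. by rewrite ffunE pnatr_eq0. Qed.

Lemma drawn_le w i : drawn R m w i <= N%:R.
Proof. by rewrite ffunE ler_nat block_lt. Qed.

Lemma run_main (w : T.-tuple bool) :
  exists2 s, run (main_cmd k) T L B w = ([::], s) &
    main_inv k L B w (fun x => xsupp x \in bases M) ('C(m, d)%:R ^+ 2)
      (k * m) s.
Proof.
apply: (run_wp _ T_cost); apply: wp_main => //.
- by rewrite leq_add2r leq_pmull.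
- by rewrite (leq_trans dm) // (leq_trans (leq_pmull m (ltn0Sn k))) // leq_addr.
- by rewrite mulSn; lia.
- by rewrite size_tuple.
- by move=> x; apply: default_basis.
- by move=> r x _; apply: (trial_basis LE rankM repB) => i; apply: drawn_neq0.
- by move=> r x _; apply: (trial_ratio LE psdH) => i; apply: drawn_neq0.
- exact: sqr_ge0.
Qed.

Lemma run_ok (w : T.-tuple bool) : halted (run (main_cmd k) T L B w) /\ S_ w \in bases M.
Proof.
have [s -> [_ Gs _ _ _]] := run_main w; split=> //.
suff -> : output m ([::], s) = xsupp (out m s) by [].
by apply/setP => i; rewrite !inE ffunE.
Qed.

(** With [g] the value at the draw and [D] the minor at the output,
    [\det H * c ^ 2 * (N / 256) ^ (2 d)] is at most [\det H * g ^ 2], which is at most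
    ['C(m, d) ^ 2] times the record, and the record is at most [N ^ (2 d) * D]. The powers of [N]
    cancel. *)
Lemma good_draw S (w : T.-tuple bool) r : S \in bases M -> (r < k * m)%N ->
    ~~ bad_draw S (drop (r * (m * (m + 3))) w) ->
  \det (principal_submx L S) <=
  \det (principal_submx L (S_ w)) * (256 ^ d * 'C(m, d))%:R ^+ 2.
Proof.
move=> bS rk; rewrite -leNgt => good.
have [s -> [_ Gs hb b0 hr]] := run_main w.
have {}hr := hr r rk; set b := rarr s 12 0 0 in hb b0 hr.
have -> : output m ([::], s) = xsupp (out m s).
  by apply/setP => i; rewrite !inE ffunE.
set x := out m s in Gs hb *; set D := \det (principal_submx L (xsupp x)).
have N0 : 0 < N%:R :> R by rewrite ltr0n expn_gt0.
have D0 : 0 <= D by rewrite /D (det_basis LE rankM tuB repB) // mulr_ge0 ?sqr_ge0 ?det_psd_ge0.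
(* The surviving weights are drawn ones, hence at most [N]; with the default output the record is
   0. *)
have bD : b <= N%:R ^+ (2 * d) * D.
  case: hb => [-> | [-> [r' _ g]]]; first by rewrite mulr_ge0 ?exprn_ge0.
  rewrite (congdet_supp LE rankM tuB repB) //; apply: ler_wpM2r => //.
  have cx : #|xsupp x| = d by rewrite (basis_card Gs).
  rewrite exprM -[in leRHS]cx -prodr_const; apply: ler_prod => i _.
  rewrite sqr_ge0 /= lerXn2r ?nnegrE //.
    by have [_ /(_ i)[->|->]] := greedy_supp g => //; rewrite ffunE.
  by have [_ /(_ i)[->|->]] := greedy_supp g => //; apply: drawn_le.
rewrite (congdet_mpeval _ LE) in hr.
rewrite (det_basis LE rankM tuB repB) //.
set c := paircoef B C S in good *; set h := \det H in hr *.
have h0 : 0 <= h by apply: det_psd_ge0.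
have p0 : 0 < N%:R ^+ (2 * d) :> R by rewrite exprn_gt0.
set g := mpeval _ _ in good hr.
have c2 : c ^+ 2 * (N%:R / 256) ^+ (2 * d) <= g ^+ 2.
  rewrite mulnC exprM -exprMn -[leLHS]real_normK ?num_real // -[leRHS]real_normK ?num_real //.
  have q0 : 0 <= (N%:R / 256) ^+ d :> R by rewrite exprn_ge0 // divr_ge0.
  by rewrite lerXn2r ?nnegrE ?normr_ge0 // normrM (ger0_norm q0).
have e0 : 0 < 256 ^+ (2 * d) :> R by rewrite exprn_gt0.
rewrite -(ler_pM2r p0) -(ler_pM2r (_ : 0 < (256 ^+ (2 * d))^-1)) ?invr_gt0 //.
apply: le_trans (_ : h * g ^+ 2 <= _).
  have -> : h * c ^+ 2 * N%:R ^+ (2 * d) / 256 ^+ (2 * d) =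
    h * (c ^+ 2 * (N%:R / 256) ^+ (2 * d)).
    by rewrite expr_div_n !mulrA.
  exact: ler_wpM2l.
apply: le_trans hr _.
have -> : D * (256 ^ d * 'C(m, d))%:R ^+ 2 * N%:R ^+ (2 * d) / 256 ^+ (2 * d) =
  N%:R ^+ (2 * d) * D * 'C(m, d)%:R ^+ 2.
  have -> : (256 ^ d * 'C(m, d))%:R ^+ 2 = 256 ^+ (2 * d) * 'C(m, d)%:R ^+ 2 :> R.
    by rewrite natrM natrX exprMn -exprM mulnC.
  by field; rewrite gt_eqF.
by apply: ler_wpM2r => //; apply: sqr_ge0.
Qed.

Lemma card_bad_tapes S : S \in bases M -> (0 < d)%N ->
  (2 ^ (k * m) * #|[set w : T.-tuple bool |
     all (fun r => bad_draw S (drop (r * (m * (m + 3))) w)) (iota 0 (k * m))]|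
   <= 2 ^ T)%N.
Proof.
move=> bS d0; apply: card_all_blocks => //.
  by move=> w; rewrite /bad_draw -!gridval_of grid_of_take.
have cS : #|S| = d by rewrite (basis_card bS).
pose bad (x : {ffun 'I_m -> 'I_N}) :=
  `|mpeval (paircoef B C) (gridval R x)| < `|paircoef B C S| * (N%:R / 256) ^+ d.
have -> : [set u : (m * (m + 3)).-tuple bool | bad_draw S u] =
  [set u : (m * (m + 3)).-tuple bool | bad (grid_of m u)].
  by apply/setP => u; rewrite !inE /bad_draw -gridval_of.
apply: (@card_bad_tape m bad); apply: anticoncentration => //.
- by rewrite expn_gt0.
- exact: paircoef_homog.
(* [8 * d <= N] because [N = 8 * 2 ^ m] and [d <= m < 2 ^ m]. *)
rewrite expnD mulnC leq_mul2r /=; apply: leq_trans dm _.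
by apply: ltnW; apply: ltn_expl.
Qed.

End Trials.

Lemma coin_prob_ge (R : realType) (T n : nat) (E F : pred (T.-tuple bool)) :
    (forall w, ~~ E w -> F w) ->
    (2 ^ n * #|[set w | F w]| <= 2 ^ T)%N ->
  1 - (2 ^+ n)^-1 <= coin_prob R E.
Proof.
move=> EF hF; rewrite /coin_prob.
have p2 j : 0 < 2 ^+ j :> R by rewrite exprn_gt0.
rewrite ler_pdivlMr //.
have : (2 ^ T <= #|[set w | E w]| + #|[set w | F w]|)%N.
  rewrite -card_bool -card_tuple -(cardC [set w | E w]) cardsE leq_add2l.
  by apply/subset_leq_card/subsetP => w; rewrite !inE => /EF.
rewrite -(ler_nat R) natrD natrX => hE.
have : #|[set w | F w]|%:R <= (2 ^+ n)^-1 * 2 ^+ T :> R.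
  by rewrite mulrC ler_pdivlMr // mulrC -!natrX -natrM ler_nat.
by rewrite mulrBl mul1r; lra.
Qed.

Theorem theorem1p4 (R : realType) :
  exists C : R, forall k : nat, exists (P : cmd) (p : {poly nat}),
    forall (m d : nat) (L : 'M[R]_m) (B : 'M[R]_(d, m)) (M : matroid 'I_m),
      psdmx L -> \rank L = d ->
      regular_matroid R M -> matroid_rank M = d ->
      totally_unimodular B -> represents B M ->
      let T := p.[m] in
      let S (w : T.-tuple bool) := output m (run P T L B w) in
      (forall w : T.-tuple bool,
         halted (run P T L B w) /\ S w \in bases M) /\
      1 - (m%:R ^+ k)^-1 <=
        coin_prob R (fun w : T.-tuple bool =>
          Num.max (2 `^ (- (C * m%:R))) (2 `^ (- (C * (d%:R * ln m%:R))))
            * OPT L M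
          <= \det (principal_submx L (S w))).
Proof.
exists 36 => k; have [pc hpc] := cost_poly k.+1 (main_cmd k).
(* The first summand pays for the running time, the second for the coins of [k * m] trials, each
   drawing [m] weights of [m + 3] bits. *)
exists (main_cmd k), (pc + k%:P * 'X * ('X * ('X + 3%:P))).
move=> m d L B M psdL rL _; case: d / rL B => B rankM tuB repB T S.
have [C [H [LE psdH]]] := psd_rank_fact psdL.
have TE : T = (cost (k.+1 * m + 3) (main_cmd k) + k * m * (m * (m + 3)))%N.
  by rewrite hpc /T !(hornerD, hornerM, hornerC, hornerX).
have Tc : (cost (k.+1 * m + 3) (main_cmd k) <= T)%N by rewrite TE leq_addr.
have Tw : (k * m * (m * (m + 3)) <= T)%N by rewrite TE leq_addl.
have ok w := run_ok psdL LE psdH rankM tuB repB Tc Tw w.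
split; first exact: ok.
clearbody T.
(* The optimal basis is fixed before any coin is tossed, so only the bad event of this single set
   has to be bounded. *)
have [S0 bS0 OE] := OPT_attained LE psdH rankM tuB repB.
have dm := rank_leq_row L.
have prob_ge0 (E : T.-tuple bool -> bool) : 0 <= coin_prob R E.
  by rewrite /coin_prob divr_ge0 ?exprn_ge0.
set f := Num.max _ _.
(* In rank 0 the empty set is the only basis and the approximation factor is 1; [anticoncentration]
   covers only [d > 0]. *)
have [d0 | dpos] := posnP (\rank L).
  have E w : f * OPT L M <= \det (principal_submx L (S w)).
    have -> : S w = S0.
      have c0 : #|S0| = 0%N by rewrite (basis_card bS0) rankM.
      have c1 : #|S w| = 0%N by rewrite (basis_card (ok w).2) rankM.
      by rewrite (cards0_eq c0) (cards0_eq c1).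
    rewrite -OE /f d0 mul0r mulr0 oppr0 powRr0 max_r ?mul1r //.
    by rewrite powRN invf_le1 ?powR_gt0 // -[leLHS](powRr0 2) ler_powR // ?ler1n // mulr_ge0.
  rewrite /coin_prob (eq_card (_ : _ =i setT)) ?cardsT; last first.
    by move=> w; rewrite !inE E.
  rewrite card_tuple card_bool natrX divff ?gt_eqF ?exprn_gt0 //.
  by rewrite lerBlDr lerDl invr_ge0 exprn_ge0.
(* Here [m = 1] and the claimed probability is 0; [factor_log] covers only [m > 1]. *)
have [m1 | m2] := leqP m 1.
  apply: le_trans (prob_ge0 _).
  have -> : m%:R = 1 :> R.
    by apply/eqP; rewrite pnatr_eq1 eqn_leq m1 (leq_trans dpos).
  by rewrite expr1n invr1 subrr.
(* The [k * m] trials give [2 ^ (k m)], which is at least [m ^ k] since [m <= 2 ^ m]. *)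
apply: le_trans (_ : 1 - (2 ^+ (k * m))^-1 <= _).
  rewrite lerD2l lerN2 lef_pV2 ?posrE ?exprn_gt0 ?ltr0n // ?(ltnW m2) //.
  rewrite mulnC exprM lerXn2r ?nnegrE ?exprn_ge0 // -natrX ler_nat.
  by apply: ltnW; apply: ltn_expl.
pose all_bad (w : T.-tuple bool) :=
  all (fun r => bad_draw B C S0 (drop (r * (m * (m + 3))) w)) (iota 0 (k * m)).
have := card_bad_tapes B C rankM Tw bS0 dpos.
apply: (@coin_prob_ge R T _ _ all_bad) => w.
apply: contraR => /allPn[r]; rewrite mem_iota add0n /= => rk good.
have := good_draw psdL LE psdH rankM tuB repB Tc Tw bS0 rk good.
rewrite -OE -/(S w); set D := \det _; set K := _ ^+ 2 => OD.
have D0 : 0 <= D.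
  by rewrite /D (det_basis LE rankM tuB repB (ok w).2) mulr_ge0 ?sqr_ge0 ?det_psd_ge0.
have f0 : 0 <= f by rewrite /f le_max powR_ge0.
have fK : f * K <= 1.
  rewrite /f maxEle; case: ifP => _; first exact: factor_log.
  exact: factor_linear.
apply: le_trans (ler_wpM2l f0 OD) _.
by rewrite mulrCA -[leRHS]mulr1 ler_wpM2l.
Qed.
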